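(* Let $X=[0,1]$ be equipped with the Borel $\sigma$-field and the Lebesgue measure $m$. Let $k\ge1$, let $p_1,\dots,p_k>0$ with $\sum_{i=1}^kp_i=1$, and let $f_1,\dots,f_k:X\to X$ be piecewise $C^2$ nonsingular transformations, each with a finite partition. Assume that $$\sum_{i=1}^k\frac{p_i}{|f_i'(x)|}<1\quad\text{for every }x\in X,$$ where, when $x$ is a discontinuity point of some $f_i$, the inequality is required with the left and right limits of $f_i'$ at $x$ in place of $f_i'(x)$. Let $\mathcal L_f=\sum_{i=1}^kp_i\mathcal L_i$, where $\mathcal L_i$ is the Perron--Frobenius operator of $f_i$ on $L^1(m)$. Then $\mathcal L_f$ satisfies (C), but does not satisfy (UC).
   Context: A map $g:X\to X$ is nonsingular if $m(A)=0$ implies $m(g^{-1}A)=0$. Its Perron--Frobenius operator $\mathcal L_g$ is defined by $\int_A\mathcal L_g\varphi\,dm=\int_{g^{-1}(A)}\varphi\,dm$ for all $\varphi\in L^1(m)$ and Borel $A$. Piecewise $C^2$ with a finite partition means that there is a finite partition of $[0,1]$ into intervals such that the map restricted to the interior of each interval extends to a $C^2$ function on its closure. $D(m)=\{h\in L^1(m):h\ge0\ m\text{-a.e.},\ \|h\|=1\}$ and $d(\varphi,F)=\inf_{\psi\in F}\|\varphi-\psi\|$ ($L^1(m)$-norm). (C) (constrictive), for a Markov operator $P$: there is a compact set $F\subset L^1(m)$ with $\lim_{n\to\infty}d(P^nh,F)=0$ for every $h\in D(m)$. (UC) (uniformly constrictive): there is a compact set $F\subset L^1(m)$ with $\lim_{n\to\infty}\sup_{h\in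 D(m)}d(P^nh,F)=0$. *)

(* Defs.v *)
From HB Require Import structures.
From mathcomp Require Import all_boot all_order all_algebra.
From mathcomp Require Import all_classical all_reals all_analysis.
From mathcomp Require Import measurable_realfun.
Set Implicit Arguments.
Unset Strict Implicit.
Unset Printing Implicit Defensive.
Import Order.TTheory GRing.Theory Num.Theory numFieldNormedType.Exports.
Local Open Scope classical_set_scope.
Local Open Scope ring_scope.

(* [LspaceType1 mu] is the library's type of a.e.-equality classes of
   integrable functions; it comes without algebraic or topological structure.
   We make it a normed module. [L1repr] picks an integrable function in a class
   and [L1cls] takes the class of an integrable function. *)
Section L1_space.
Local Open Scope quotient_scope.
Context d (T : measurableType d) (R : realType).
Variable mu : {measure set T -> \bar R}.
Notation L1 := (LspaceType1 mu).
Notation Lf := (LfunType mu (@lexx _ _ 1%E)).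

Definition L1fun (u : L1) : T -> R := u : T -> measurableTypeR R.

Lemma L1fun_Lfun (u : L1) : L1fun u \in Lfun mu 1.
Proof.
rewrite inE; apply/andP; split; rewrite inE /=.
  rewrite /L1fun /aqEqMfun_to_fun.
  by set g := repr _; exact: (@measurable_funPT _ _ _ _ g).
exact: (@Lebesgue_finite _ _ _ _ _ _ u).
Qed.

Definition L1repr (u : L1) : Lf := Lfun_Sub (@lexx _ _ 1%E) (L1fun_Lfun u).

Lemma Lf_mfun (f : Lf) : (f : T -> measurableTypeR R) \in mfun.
Proof. by rewrite inE /=; exact: (@measurable_funPT _ _ _ _ f). Qed.

Definition Lf_class (f : Lf) : {mfun_ mu, T >-> measurableTypeR R} :=
  \pi_({mfun_ mu, T >-> measurableTypeR R}) (mfun_Sub (Lf_mfun f)).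

Lemma Lf_classK (f : Lf) : (Lf_class f : T -> R) = f %[ae mu].
Proof.
apply: (asboolW (P := ((_ : T -> measurableTypeR R) = f %[ae mu]))).
have := reprK (Lf_class f).
by move/eqmodP.
Qed.

Lemma Lf_class_meas (f : Lf) : measurable_fun setT (Lf_class f : T -> R).
Proof.
rewrite /aqEqMfun_to_fun.
by set g := repr _; exact: (@measurable_funPT _ _ _ _ g).
Qed.

Lemma ae_eq_Lnorm1 (f g : T -> R) :
  measurable_fun setT f -> measurable_fun setT g ->
  f = g %[ae mu] -> ('N[mu]_1[EFin \o f] = 'N[mu]_1[EFin \o g])%E.
Proof.
move=> mf mg fg; rewrite !Lnorm1; apply: ge0_ae_eq_integral => //.
- by apply/(measurable_EFinP _ (Num.norm \o f))/measurableT_comp.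
- by apply/(measurable_EFinP _ (Num.norm \o g))/measurableT_comp.
- by apply: filterS fg => x /= + _ => /(_ Logic.I) ->.
Qed.

Lemma Lf_class_finite (f : Lf) : finite_norm mu 1 (Lf_class f).
Proof.
rewrite /finite_norm (ae_eq_Lnorm1 (Lf_class_meas f) _ (Lf_classK f))//.
exact: Lfunction_finite.
Qed.

Definition L1cls (f : Lf) : L1 :=
  LebesgueSpace.Pack (LebesgueSpace.Class
     (isFinLebesgue.Build _ _ _ _ _ (@lexx _ _ 1%E) _ (Lf_class_finite f))).

Lemma L1clsK (f : Lf) : L1repr (L1cls f) = f %[ae mu].
Proof. exact: Lf_classK. Qed.

Lemma L1eqP (u v : L1) : L1repr u = L1repr v %[ae mu] -> u = v.
Proof.
move=> uv.
have {uv} : LebesgueSpace.sort u = LebesgueSpace.sort v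
    :> {mfun_ mu, T >-> measurableTypeR R}.
  by rewrite -[LHS]reprK -[RHS]reprK; apply/eqmodP/asboolP; exact: uv.
case: u => u [[Hu]]; case: v => v [[Hv]] /= uv.
by rewrite uv in Hu *; rewrite (Prop_irrelevance Hu Hv).
Qed.

Lemma L1reprK : cancel L1repr L1cls.
Proof. by move=> u; apply: L1eqP; exact: L1clsK. Qed.

Lemma L1clsP (f g : Lf) : L1cls f = L1cls g <-> f = g %[ae mu].
Proof.
split=> [fg|fg].
  have := L1clsK f; rewrite fg => /ae_eq_sym fK.
  exact: (ae_eq_trans fK (L1clsK g)).
apply: L1eqP; apply: (ae_eq_trans (L1clsK f)).
by apply: (ae_eq_trans fg); exact: ae_eq_sym (L1clsK g).
Qed.

Definition L1zero : L1 := L1cls 0.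
Definition L1add (u v : L1) : L1 := L1cls (L1repr u + L1repr v).
Definition L1opp (u : L1) : L1 := L1cls (- L1repr u).
Definition L1scale (a : R) (u : L1) : L1 := L1cls (a *: L1repr u).
Definition L1norm (u : L1) : R := fine ('N[mu]_1[EFin \o L1repr u])%E.

Lemma L1addE f g : L1add (L1cls f) (L1cls g) = L1cls (f + g).
Proof.
apply/L1clsP; have := L1clsK f; have := L1clsK g.
by apply: filterS2 => x /= gx fx _; rewrite !fctE gx// fx.
Qed.

Lemma L1oppE f : L1opp (L1cls f) = L1cls (- f).
Proof.
by apply/L1clsP; have := L1clsK f; apply: filterS => x /= fx _;
  rewrite !fctE fx.
Qed.

Lemma L1scaleE a f : L1scale a (L1cls f) = L1cls (a *: f).
Proof.
by apply/L1clsP; have := L1clsK f; apply: filterS => x /= fx _;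
  rewrite !fctE fx.
Qed.

Lemma L1normE f : L1norm (L1cls f) = fine ('N[mu]_1[EFin \o f])%E.
Proof. by congr fine; apply: ae_eq_Lnorm1 => //; exact: L1clsK. Qed.

Lemma L1addA : associative L1add.
Proof.
move=> u v w; rewrite -(L1reprK u) -(L1reprK v) -(L1reprK w).
by rewrite !L1addE addrA.
Qed.

Lemma L1addC : commutative L1add.
Proof. by move=> u v; rewrite /L1add addrC. Qed.

Lemma L1add0 : left_id L1zero L1add.
Proof. by move=> u; rewrite -(L1reprK u) L1addE add0r. Qed.

Lemma L1addN : left_inverse L1zero L1opp L1add.
Proof. by move=> u; rewrite -(L1reprK u) L1oppE L1addE addNr. Qed.

HB.instance Definition _ := gen_eqMixin (LspaceType1 mu).
HB.instance Definition _ := gen_choiceMixin (LspaceType1 mu).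
HB.instance Definition _ :=
  GRing.isZmodule.Build (LspaceType1 mu) L1addA L1addC L1add0 L1addN.

Lemma L1scaleA a b (u : L1) : L1scale a (L1scale b u) = L1scale (a * b) u.
Proof. by rewrite -(L1reprK u) !L1scaleE scalerA. Qed.

Lemma L1scale1 : left_id 1 L1scale.
Proof. by move=> u; rewrite -(L1reprK u) !L1scaleE scale1r. Qed.

Lemma L1scaleDr : right_distributive L1scale +%R.
Proof.
move=> a u v; rewrite -(L1reprK u) -(L1reprK v) /GRing.add/=.
by rewrite !(L1scaleE, L1addE) scalerDr.
Qed.

Lemma L1scaleDl (u : L1) : {morph L1scale^~ u : a b / a + b}.
Proof.
by move=> a b; rewrite -(L1reprK u) !L1scaleE [RHS]L1addE scalerDl.
Qed.

HB.instance Definition _ := GRing.Zmodule_isLmodule.Build R (LspaceType1 mu)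
  L1scaleA L1scale1 L1scaleDr L1scaleDl.

Lemma L1normD (u v : L1) : L1norm (u + v) <= L1norm u + L1norm v.
Proof.
rewrite -(L1reprK u) -(L1reprK v) [X in L1norm X]L1addE !L1normE.
exact: ler_LnormD.
Qed.

Lemma L1normZ a (u : L1) : L1norm (a *: u) = `|a| * L1norm u.
Proof.
rewrite -(L1reprK u) [X in L1norm X]L1scaleE !L1normE.
by apply/EFin_inj; rewrite EFinM !finite_norm_fine; exact: LnormZ.
Qed.

Lemma L1norm0_eq0 (u : L1) : L1norm u = 0 -> u = 0.
Proof.
move=> /fine_Lnormr_eq0 u0; apply: L1eqP; apply: (ae_eq_trans u0).
exact/ae_eq_sym/(L1clsK 0).
Qed.

HB.instance Definition _ := Lmodule_isNormed.Build R (LspaceType1 mu)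
  L1normD L1normZ L1norm0_eq0.

End L1_space.

Notation unit_itv R := (`[0%R, 1%R]%classic : set R).

(* The measure space X = [0,1] is represented by the real line carrying
   Lebesgue measure restricted to [0,1], so that L^1(leb01) is L^1([0,1]).
   A map g : X -> X is a function g : R -> R preserving [0,1], whose values
   outside [0,1] are irrelevant: the preimage of A under the map of X is
   unit_itv R `&` g @^-1` A. *)
Section unit_interval_dynamics.
Context {R : realType}.
Notation I := (unit_itv R).

Definition leb01 : set (measurableTypeR R) -> \bar R :=
  mrestr lebesgue_measure (measurable_itv `[0%R, 1%R]).
HB.instance Definition _ := Measure.on leb01.

Lemma leb01_fin : fin_num_fun leb01.
Proof.
apply: lty_fin_num_fun; rewrite /= /leb01 /mrestr /= setTI.
by rewrite lebesgue_measure_itv/= lte_fin ltr01 sube0 ltry.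
Qed.

HB.instance Definition _ := Measure_isFinite.Build _ _ _ leb01 leb01_fin.

Notation m := leb01.
Notation L1 := (LspaceType1 leb01).

Definition nonsingular (g : R -> R) :=
  measurable_fun I g /\
  forall A : set R, measurable A -> m A = 0 -> m (I `&` g @^-1` A) = 0.

Definition perron_frobenius_spec (g : R -> R) (phi psi : L1) :=
  forall A : set R, measurable A ->
    (\int[m]_(x in A) (L1repr psi x)%:E
     = \int[m]_(x in I `&` g @^-1` A) (L1repr phi x)%:E)%E.

Definition perron_frobenius (g : R -> R) (phi : L1) : L1 :=
  xget 0 [set psi | perron_frobenius_spec g phi psi].

Lemma L1repr_integrable (u : L1) : m.-integrable setT (EFin \o L1repr u).
Proof. by apply/Lfun1_integrable; exact: LfunP. Qed.

Lemma perron_frobenius_spec_unique g phi psi1 psi2 :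
  perron_frobenius_spec g phi psi1 -> perron_frobenius_spec g phi psi2 ->
  psi1 = psi2.
Proof.
move=> h1 h2; apply: L1eqP.
have : ae_eq m setT (EFin \o L1repr psi1) (EFin \o L1repr psi2).
  apply: integral_ae_eq => //; first exact: L1repr_integrable.
    by apply/measurable_EFinP; exact: measurable_funPT.
  by move=> A _ mA; rewrite [LHS]h1// [RHS]h2.
by apply: filterS => x /= + _ => /(_ Logic.I) [].
Qed.

Lemma perron_frobenius_spec_exists g phi : nonsingular g ->
  exists psi, perron_frobenius_spec g phi psi.
Proof.
move=> [mg ng].
pose g' : R -> R := g \_ I.
have mI : measurable I by exact: measurable_itv.
have mg' : @measurable_fun _ _ (measurableTypeR R) (measurableTypeR R) setT g'.
  by apply/(measurable_restrictT g mI).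
have g'E A : g' @^-1` A `&` I = I `&` g @^-1` A.
  rewrite setIC; apply/seteqP; split=> x /= [Ix]; rewrite /g' patchE mem_set//.
have mI' : measurable (I : set (measurableTypeR R)) by exact: mI.
have intphi : m.-integrable setT ((EFin \o L1repr phi) \_ I).
  apply/(integrable_mkcond _ mI').
  exact: integrableS (L1repr_integrable phi).
pose nu : {charge set (measurableTypeR R) -> \bar R} :=
  measure_function_pushforward__canonical__charge_Charge
    (induced_charge intphi) mg'.
have nuE A : nu A = (\int[m]_(x in I `&` g @^-1` A) (L1repr phi x)%:E)%E.
  by rewrite /nu /= /pushforward /induced_charge -g'E integral_mkcondr.
have num : nu `<< m.
  apply/null_content_dominatesP => A mA mA0; rewrite nuE.
  apply: null_set_integral; [exact: mg|..|exact: ng].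
  by apply/measurable_EFinP; apply: measurable_funTS; exact: measurable_funPT.
pose rn : measurableTypeR R -> \bar R := Radon_Nikodym nu m.
have rnE A : measurable A -> nu A = (\int[m]_(x in A) rn x)%E.
  exact: Radon_Nikodym_integral.
have rnf x : rn x = (fine (rn x))%:E.
  by rewrite fineK//; exact: Radon_Nikodym_fin_num.
have frnL : (fine \o rn) \in Lfun m 1.
  apply/Lfun1_integrable.
  rewrite (_ : EFin \o _ = rn); first exact: Radon_Nikodym_integrable.
  by apply/funext => x /=; rewrite -rnf.
exists (L1cls (Lfun_Sub (@lexx _ _ 1%E) frnL)) => A mA.
rewrite -nuE rnE//.
apply: ae_eq_integral => //.
- by apply/measurable_EFinP; apply: measurable_funTS; exact: measurable_funPT.
- apply: measurable_funTS.
  by have /integrableP[] := Radon_Nikodym_integrable num.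
have := L1clsK (Lfun_Sub (@lexx _ _ 1%E) frnL).
by apply: filterS => x /= frx _; rewrite [RHS]rnf frx.
Qed.

Lemma perron_frobeniusP g phi : nonsingular g ->
  perron_frobenius_spec g phi (perron_frobenius g phi).
Proof.
move=> /(perron_frobenius_spec_exists phi) h; exact: (@xgetPex _ 0 [set psi | perron_frobenius_spec g phi psi]).
Qed.

(* [deriv_on K g g1]: at each point of K, g1 is the derivative of g within K,
   hence a one-sided derivative at an end-point of a closed interval K. *)
Definition deriv_on (K : set R) (g g1 : R -> R) :=
  forall x, K x -> (g y - g x) / (y - x) @[y --> within K x^'] --> g1 x.

Definition C2_on (K : set R) (g : R -> R) :=
  exists g1 g2 : R -> R,
    [/\ deriv_on K g g1, deriv_on K g1 g2 & {within K, continuous g2}].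

Definition piecewise_C2 (g : R -> R) :=
  exists (n : nat) (J : 'I_n -> set R),
    [/\ forall j, is_interval (J j),
        partition setT J I &
        forall j, exists2 G : R -> R, C2_on (closure (J j)) G &
          forall x, interior (J j) x -> g x = G x].

(* The weighted sum of inverse slopes is < 1. A zero slope makes the sum
   infinite; it is excluded explicitly because 0^-1 = 0 in the library. *)
Definition slopes_subunit k (p s : 'I_k -> R) :=
  (forall i, s i != 0) /\ \sum_(i < k) p i / `|s i| < 1.

(* Where some f i is not differentiable, and at the end-points of [0,1], the
   condition is imposed on the one-sided limits of the derivatives (on the
   right for x < 1 and on the left for 0 < x). *)
Definition mean_expanding k (p : 'I_k -> R) (f : 'I_k -> R -> R) :=
  forall x, I x ->
    let regular := 0 < x < 1 /\ forall i, derivable (f i) x 1 in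
    (regular -> slopes_subunit p (fun i => derive1 (f i) x)) /\
    (~ regular ->
      (x < 1 ->
        slopes_subunit p (fun i => lim (derive1 (f i) y @[y --> x^'+]))) /\
      (0 < x ->
        slopes_subunit p (fun i => lim (derive1 (f i) y @[y --> x^'-])))).

Definition mean_perron_frobenius k (p : 'I_k -> R) (f : 'I_k -> R -> R)
    (phi : L1) : L1 :=
  \sum_(i < k) p i *: perron_frobenius (f i) phi.

Definition densities : set L1 :=
  [set h | {ae m, forall x, 0 <= L1repr h x} /\ `|h| = 1].

(* Extended-real valued, so that the distance to the empty set is +oo. *)
Definition L1dist (phi : L1) (F : set L1) : \bar R :=
  ereal_inf [set `|phi - psi|%:E | psi in F].

Definition constrictive (P : L1 -> L1) :=
  exists2 F : set L1, compact F &
    forall h, densities h -> L1dist (iter n P h) F @[n --> \oo] --> 0%E.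

Definition uniformly_constrictive (P : L1 -> L1) :=
  exists2 F : set L1, compact F &
    ereal_sup [set L1dist (iter n P h) F | h in densities] @[n --> \oo] --> 0%E.

End unit_interval_dynamics.

(* Main.v *)
Require Import Defs.
From mathcomp Require Import all_boot all_order all_algebra.
From mathcomp Require Import all_classical all_reals all_analysis.
From mathcomp Require Import measurable_realfun.
From mathcomp Require Import ring lra.

(** Write P for the averaged operator, <u, g> for the integral of u g over
    [0,1] and alpha < 1 for a bound of the sums of the p_i / |f_i'|.

    Why P is constrictive.  The adjoint of P sends g to the sum of the
    p_i (g o f_i).  If g = phi', the chain rule gives, away from the break
    points of the maps,
      sum p_i (g o f_i) = (sum p_i (phi o f_i) / f_i')'
                          - sum p_i (phi o f_i) (1 / f_i')'.
    So passing from P u to u replaces the primitive phi by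
    Q phi = sum p_i (phi o f_i) / f_i', whose sup norm is smaller by the
    factor alpha, at the price of an error of order |phi|_oo |u|_1
    [pairing_step].  Iterating n times [pairing_iter] multiplies |phi|_oo by
    alpha ^ n; on the side of test functions each step involves single maps
    and not their compositions.  The function Q^n phi jumps, but only on a
    finite set that depends on n and not on phi.  Subtracting from the n-th test function its
    averages over the gaps of this set makes its primitive continuous, at most
    doubles the sup norm of the primitive, and costs another O(|phi|_oo |u|_1).
    Let var u be the least K such that |<u, phi'>| <= K |phi|_oo for all phi
    vanishing at 0, a dual form of the total variation [var_le].  Then
      var (P^n u) <= 2 alpha ^ n var u + C_n |u|_1            [lasota_yorke].
    The factor 2 is the reason for iterating first: for some n one has
    2 alpha ^ n <= 1/2, and every u of norm at most 2 and of finite variation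
    ends up in a fixed ball |u|_1 <= 2, var u <= K0 [var_le_attractor].  Such a ball is compact
    in L^1 [compact_var_ball], functions of finite variation are dense
    [var_le_dense] and P is a contraction, so the ball attracts every density.

    The bound alpha exists because the weighted sum of inverse slopes is < 1
    at each point and in the limit on each side of it, and [0,1] is compact
    [mean_expanding_bounds].

    Why P is not uniformly constrictive.  Fix n.  Outside a finite set of
    points x, all orbits of length n issued from x, along any choice of maps,
    avoid the break points, so that a neighbourhood of x is mapped into an
    arbitrarily small neighbourhood U of the finite set of their end-points
    [koopman_indic_near].  The n-th iterate of a density carried by that
    neighbourhood of x is carried by U, while a compact subset of L^1 is
    uniformly integrable [compact_uniformly_integrable].  Hence some density
    is still at distance 1/2 from the compact set after n steps
    [iter_density_far]. *)

Set Implicit Arguments.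
Unset Strict Implicit.
Unset Printing Implicit Defensive.
Import Order.TTheory GRing.Theory Num.Theory numFieldNormedType.Exports.
Local Open Scope classical_set_scope.
Local Open Scope ring_scope.

(** * Lebesgue measure restricted to the unit interval *)

Section restricted_measure.
Context {R : realType}.
Notation mu := (@lebesgue_measure R).
Notation I := (unit_itv R).
Notation m := (@leb01 R).
Notation L1 := (LspaceType1 (@leb01 R)).

Lemma leb01E (A : set R) : m A = mu (A `&` I). Proof. by []. Qed.

Lemma leb01_integral (f : R -> \bar R) :
  (\int[m]_(x in I) f x = \int[mu]_(x in I) f x)%E.
Proof.
apply: eq_measure_integral => A mA AI.
by rewrite [LHS]leb01E setIidl.
Qed.

Lemma leb01_integralS (A : set R) (f : R -> \bar R) : measurable A -> A `<=` I ->
  (\int[m]_(x in A) f x = \int[mu]_(x in A) f x)%E.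
Proof.
move=> mA AI; apply: eq_measure_integral => B mB BA.
rewrite [LHS]leb01E setIidl//; exact: subset_trans AI.
Qed.

Lemma lebesgue_aeS (P Q : R -> Prop) : (forall x, P x -> Q x) ->
  {ae mu, forall x, P x} -> {ae mu, forall x, Q x}.
Proof.
move=> PQ; apply: filterS PQ; exact: (ae_filter_ringOfSetsType mu).
Qed.

Lemma lebesgue_aeS2 (P Q S : R -> Prop) : (forall x, P x -> Q x -> S x) ->
  {ae mu, forall x, P x} -> {ae mu, forall x, Q x} -> {ae mu, forall x, S x}.
Proof.
move=> PQS; apply: filterS2 PQS; exact: (ae_filter_ringOfSetsType mu).
Qed.

Lemma unit_itvm : measurable I. Proof. exact: measurable_itv. Qed.

Lemma lebesgue_unit_itv : (mu I = 1)%E.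
Proof. by rewrite lebesgue_measure_itv/= lte_fin ltr01 sube0. Qed.

Lemma leb01_I_ae (P : R -> Prop) :
  {ae m, forall x, P x} <-> {ae mu, forall x, I x -> P x}.
Proof.
split=> -[N [mN N0 sN]].
  exists (N `&` I); split; first exact: measurableI.
    exact: N0.
  move=> x /= /not_implyP[Ix nP]; split=> //; exact: sN.
exists (N `|` ~` I); split.
- by apply: measurableU => //; apply: measurableC; exact: unit_itvm.
- rewrite [LHS]leb01E setIUl setICl setU0.
  by apply: (subset_measure0 _ _ _ N0) => //; apply: measurableI.
- move=> x /= nP; have [Ix|nIx] := pselect (I x); last by right.
  by left; apply: sN => /=; apply/not_implyP.
Qed.

Lemma leb01_integralT (f : R -> \bar R) : measurable_fun setT f ->
  (forall x, 0 <= f x)%E ->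
  (\int[m]_x f x = \int[mu]_(x in I) f x)%E.
Proof.
move=> mf f0; rewrite -leb01_integral.
apply/esym; rewrite -(setUv I) ge0_integral_setU //=; first last.
- by apply/disj_set2P; rewrite setICr.
- by rewrite setUv.
- by apply: measurableC; exact: unit_itvm.
rewrite [X in (_ + X)%E](_ : _ = 0%E) ?adde0//.
apply: null_set_integral.
- by apply: measurableC; exact: unit_itvm.
- exact: measurable_funTS.
- by rewrite [LHS]leb01E setICl measure0.
Qed.

Lemma L1repr_meas (u : L1) : measurable_fun setT (L1repr u : R -> R).
Proof. by have /integrableP[/measurable_EFinP] := L1repr_integrable u. Qed.

Lemma L1norm_integral (u : L1) :
  `|u| = \int[mu]_(x in I) `|L1repr u x|.
Proof.
rewrite /Num.norm /=/L1norm Lnorm1; congr fine.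
rewrite leb01_integralT//; apply: measurableT_comp => //.
by apply/measurable_EFinP; exact: L1repr_meas.
Qed.

Lemma L1repr_int (u : L1) : mu.-integrable I (EFin \o L1repr u).
Proof.
have /integrableP[mu1 ufin] := L1repr_integrable u.
apply/integrableP; split; first by apply: measurable_funTS.
rewrite -leb01_integralT//.
by apply: measurableT_comp.
Qed.

End restricted_measure.

(** * The pairing of integrable classes with bounded functions *)

Section pairing.
Context {R : realType}.
Notation mu := (@lebesgue_measure R).
Notation I := (unit_itv R).
Notation m := (@leb01 R).
Notation L1 := (LspaceType1 (@leb01 R)).

Implicit Types (u v : L1) (g h : R -> R).

Definition bounded_measurable (g : R -> R) :=
  measurable_fun I g /\ exists B : R, forall x, I x -> `|g x| <= B.

Definition pairing (u : L1) (g : R -> R) : R :=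
  \int[mu]_(x in I) (L1repr u x * g x).

Let mI : measurable I := unit_itvm.

Lemma bounded_measurable_integrableM (h g : R -> R) :
  mu.-integrable I (EFin \o h) -> bounded_measurable g ->
  mu.-integrable I (EFin \o (fun x => h x * g x)%R).
Proof.
move=> hi [mg [B gB]].
have := @integrableMr _ _ R mu _ mI g (EFin \o h) mg _ hi.
rewrite (_ : (EFin \o g) \* (EFin \o h) = EFin \o (fun x => h x * g x)%R)%E.
  apply; exists B; split; first exact: num_real.
  by move=> y By x Ix; apply: (le_trans (gB x Ix)); exact: ltW.
by apply/funext => x /=; rewrite -EFinM mulrC.
Qed.

Lemma pairing_integrable u g : bounded_measurable g ->
  mu.-integrable I (EFin \o (fun x => L1repr u x * g x)%R).
Proof. exact/bounded_measurable_integrableM/L1repr_int. Qed.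

Lemma bounded_measurable_integrable g : bounded_measurable g ->
  mu.-integrable I (EFin \o g).
Proof.
move=> [mg [B gB]]; apply: measurable_bounded_integrable => //.
  by rewrite [X in (X < _)%E]lebesgue_unit_itv ltry.
exists B; split; first exact: num_real.
by move=> y By x Ix; apply: (le_trans (gB x Ix)); exact: ltW.
Qed.

Lemma bounded_measurableD g h : bounded_measurable g -> bounded_measurable h ->
  bounded_measurable (fun x => g x + h x).
Proof.
move=> [mg [B gB]] [mh [C hC]]; split; first exact: measurable_funD.
by exists (B + C) => x Ix; rewrite (le_trans (ler_normD _ _))// lerD ?gB ?hC.
Qed.

Lemma bounded_measurableM g h : bounded_measurable g -> bounded_measurable h ->
  bounded_measurable (fun x => g x * h x).
Proof.
move=> [mg [B gB]] [mh [C hC]]; split; first exact: measurable_funM.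
by exists (B * C) => x Ix; rewrite normrM ler_pM ?gB ?hC.
Qed.

Lemma bounded_measurable_cst c : bounded_measurable (fun=> c).
Proof. by split; [exact: measurable_cst|exists `|c|]. Qed.

Lemma bounded_measurableZ c g : bounded_measurable g ->
  bounded_measurable (fun x => c * g x).
Proof. by apply: bounded_measurableM; exact: bounded_measurable_cst. Qed.

Lemma bounded_measurableN g : bounded_measurable g ->
  bounded_measurable (fun x => - g x).
Proof.
move=> /(bounded_measurableZ (-1)); congr bounded_measurable.
by apply/funext => x; rewrite mulN1r.
Qed.

Lemma bounded_measurableB g h : bounded_measurable g -> bounded_measurable h ->
  bounded_measurable (fun x => g x - h x).
Proof. by move=> ? ?; apply: bounded_measurableD => //; exact: bounded_measurableN. Qed.

Lemma bounded_measurable_sum (J : Type) (s : seq J) (h : J -> R -> R) :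
  (forall j, bounded_measurable (h j)) ->
  bounded_measurable (fun x => \sum_(j <- s) h j x).
Proof.
move=> hb; elim: s => [|j s IH].
  rewrite (_ : (fun _ => _) = fun=> 0); first exact: bounded_measurable_cst.
  by apply/funext => x; rewrite big_nil.
rewrite (_ : (fun _ => _) = fun x => h j x + \sum_(j <- s) h j x).
  exact: bounded_measurableD.
by apply/funext => x; rewrite big_cons.
Qed.

Lemma bounded_measurable_indic (A : set R) : measurable A ->
  bounded_measurable (\1_A : R -> R).
Proof.
move=> mA; split; first exact: measurable_indic.
by exists 1 => x _; rewrite indicE; case: (_ \in _); rewrite ?normr1 ?normr0 ?ler01.
Qed.

Lemma bounded_measurable_comp (f g : R -> R) :
  measurable_fun I f -> set_fun I I f -> bounded_measurable g ->
  bounded_measurable (g \o f).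
Proof.
move=> mf fI [mg [B gB]]; split.
  by apply: (measurable_comp (F := I)) => // _ [x Ix <-]; exact: fI.
by exists B => x Ix; apply: gB; exact: fI.
Qed.

Lemma pairing_eq u g h : (forall x, I x -> g x = h x) ->
  pairing u g = pairing u h.
Proof. by move=> gh; apply: eq_Rintegral => x /[!inE] Ix; rewrite gh. Qed.

Lemma pairingDr u g h : bounded_measurable g -> bounded_measurable h ->
  pairing u (fun x => g x + h x) = pairing u g + pairing u h.
Proof.
move=> bg bh; rewrite /pairing -RintegralD//; try exact: pairing_integrable.
by apply: eq_Rintegral => x _; rewrite mulrDr.
Qed.

Lemma pairingZr u c g : bounded_measurable g ->
  pairing u (fun x => c * g x) = c * pairing u g.
Proof.
move=> bg; rewrite /pairing -RintegralZl//; last exact: pairing_integrable.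
by apply: eq_Rintegral => x _; rewrite mulrCA.
Qed.

Lemma pairingBr u g h : bounded_measurable g -> bounded_measurable h ->
  pairing u (fun x => g x - h x) = pairing u g - pairing u h.
Proof.
move=> bg bh; rewrite -[in RHS]mulN1r -pairingZr// -pairingDr//.
  by apply: pairing_eq => x _; rewrite mulN1r.
exact: bounded_measurableZ.
Qed.

Lemma pairing0r u : pairing u (fun=> 0) = 0.
Proof.
rewrite (_ : (fun=> 0) = fun=> 0 * 0 :> R); last by rewrite mulr0.
by rewrite (pairingZr _ _ (bounded_measurable_cst 0)) mul0r.
Qed.

Lemma pairing_sumr u (J : Type) (s : seq J) (h : J -> R -> R) :
  (forall j, bounded_measurable (h j)) ->
  pairing u (fun x => \sum_(j <- s) h j x) = \sum_(j <- s) pairing u (h j).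
Proof.
move=> hb; elim: s => [|j s IH].
  rewrite big_nil -[RHS](pairing0r u).
  by apply: pairing_eq => x _; rewrite big_nil.
rewrite big_cons -IH -pairingDr//; last exact: bounded_measurable_sum.
by apply: pairing_eq => x _; rewrite big_cons.
Qed.

Lemma pairing_ae (u : L1) (h g : R -> R) :
  {ae mu, forall x, I x -> L1repr u x = h x} ->
  measurable_fun I h -> bounded_measurable g ->
  pairing u g = \int[mu]_(x in I) (h x * g x).
Proof.
move=> uh mh [mg _]; congr fine; apply: ae_eq_integral => //.
- apply/measurable_EFinP; apply: measurable_funM => //.
  by apply: measurable_funTS; exact: L1repr_meas.
- by apply/measurable_EFinP; apply: measurable_funM.
- by apply: lebesgue_aeS uh => x /= uh Ix; rewrite uh.
Qed.

Lemma L1norm_ae (u : L1) (h : R -> R) :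
  {ae mu, forall x, I x -> L1repr u x = h x} ->
  measurable_fun I h -> `|u| = \int[mu]_(x in I) `|h x|.
Proof.
move=> uh mh; rewrite L1norm_integral; congr fine; apply: ae_eq_integral => //.
- apply/measurable_EFinP; apply: measurableT_comp => //.
  by apply: measurable_funTS; exact: L1repr_meas.
- by apply/measurable_EFinP; apply: measurableT_comp.
- by apply: lebesgue_aeS uh => x /= uh Ix; rewrite uh.
Qed.

Lemma L1reprD (u v : L1) :
  {ae mu, forall x, I x -> L1repr (u + v) x = L1repr u x + L1repr v x}.
Proof.
apply/leb01_I_ae; have := L1clsK (L1repr u + L1repr v).
by apply: filterS => x /= /(_ Logic.I) ->.
Qed.

Lemma L1reprZ c (u : L1) :
  {ae mu, forall x, I x -> L1repr (c *: u) x = c * L1repr u x}.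
Proof.
apply/leb01_I_ae; have := L1clsK (c *: L1repr u).
by apply: filterS => x /= /(_ Logic.I) ->.
Qed.

Lemma L1repr_measI (u : L1) : measurable_fun I (L1repr u : R -> R).
Proof. by apply: measurable_funTS; exact: L1repr_meas. Qed.

Lemma pairingDl u v g : bounded_measurable g ->
  pairing (u + v) g = pairing u g + pairing v g.
Proof.
move=> bg; rewrite (pairing_ae (L1reprD u v))//; last first.
  by apply: measurable_funD; exact: L1repr_measI.
rewrite /pairing -RintegralD//; try exact: pairing_integrable.
by apply: eq_Rintegral => x _; rewrite mulrDl.
Qed.

Lemma pairingZl c u g : bounded_measurable g ->
  pairing (c *: u) g = c * pairing u g.
Proof.
move=> bg; rewrite (pairing_ae (L1reprZ c u))//; last first.
  by apply: measurable_funM => //; exact: L1repr_measI.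
rewrite /pairing -RintegralZl//; last exact: pairing_integrable.
by apply: eq_Rintegral => x _; rewrite mulrA.
Qed.

Lemma pairingBl u v g : bounded_measurable g ->
  pairing (u - v) g = pairing u g - pairing v g.
Proof. by move=> bg; rewrite -scaleN1r pairingDl// pairingZl// mulN1r. Qed.

Lemma pairing_suml (J : Type) (s : seq J) (h : J -> L1) g :
  bounded_measurable g ->
  pairing (\sum_(j <- s) h j) g = \sum_(j <- s) pairing (h j) g.
Proof.
move=> bg; elim: s => [|j s IH]; last by rewrite !big_cons pairingDl// IH.
by rewrite !big_nil -(scale0r 0) pairingZl// mul0r.
Qed.

Lemma L1repr_int_norm u :
  mu.-integrable I (EFin \o (fun x => `|L1repr u x|)%R).
Proof. exact/integrable_norm/L1repr_int. Qed.

Lemma le_pairing u g (B : R) : bounded_measurable g ->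
  (forall x, I x -> `|g x| <= B) -> `|pairing u g| <= B * `|u|.
Proof.
move=> bg gB; rewrite L1norm_integral mulrC -RintegralZr//; last first.
  exact: L1repr_int_norm.
apply: (le_trans (le_normr_Rintegral _ _)) => //; first exact: pairing_integrable.
apply: le_Rintegral => //.
- by apply: integrable_norm; exact: pairing_integrable.
- apply: bounded_measurable_integrableM; first exact: L1repr_int_norm.
  exact: bounded_measurable_cst.
- by move=> x Ix; rewrite normrM ler_wpM2l// gB.
Qed.

Lemma bounded_measurable_sg (u : L1) :
  bounded_measurable (fun x => Num.sg (L1repr u x)).
Proof.
split; last first.
  exists 1 => x _; rewrite normr_sg; by case: (_ != _).
rewrite (_ : (fun x => _) = fun x => \1_(L1repr u @^-1` `]0, +oo[) x
                                     - \1_(L1repr u @^-1` `]-oo, 0[) x :> R).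
  apply: measurable_funB; apply: measurable_indic;
  rewrite -[X in measurable X]setTI; exact: (L1repr_meas u).
apply/funext => x; rewrite !indicE.
rewrite (_ : (x \in _) = (0 < L1repr u x)); last first.
  by apply/idP/idP; rewrite inE/= in_itv/= andbT.
rewrite (_ : (x \in _) = (L1repr u x < 0)); last first.
  by apply/idP/idP; rewrite inE/= in_itv/=.
by case: sgrP => _; rewrite ?subr0 ?sub0r ?subrr.
Qed.

Lemma pairing_sg (u : L1) :
  pairing u (fun x => Num.sg (L1repr u x)) = `|u|.
Proof.
rewrite L1norm_integral; apply: eq_Rintegral => x _.
by rewrite mulrC -normrEsg.
Qed.

(** The sign of the difference is an admissible test function. *)
Lemma pairing_inj (u v : L1) :
  (forall g, bounded_measurable g -> pairing u g = pairing v g) -> u = v.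
Proof.
move=> uv; apply/eqP; rewrite -subr_eq0 -normr_eq0 -pairing_sg pairingBl.
  by rewrite uv ?subrr//; exact: bounded_measurable_sg.
exact: bounded_measurable_sg.
Qed.

Lemma L1_of_integrable (h : R -> R) : mu.-integrable I (EFin \o h) ->
  exists u : L1, {ae mu, forall x, I x -> L1repr u x = h x}.
Proof.
move=> hi.
have hL : (h \_ I) \in Lfun m 1.
  apply/Lfun1_integrable; rewrite -restrict_EFin.
  have mI' : measurable (I : set (measurableTypeR R)) by exact: unit_itvm.
  apply/(integrable_mkcond _ mI').
  have /integrableP[mh hfin] := hi.
  by apply/integrableP; split=> //; rewrite leb01_integral.
exists (L1cls (Lfun_Sub (@lexx _ _ 1%E) hL)).
have /leb01_I_ae := L1clsK (Lfun_Sub (@lexx _ _ 1%E) hL).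
apply: lebesgue_aeS => x /= + Ix => /(_ Ix Logic.I) ->.
by rewrite patchE mem_set.
Qed.

End pairing.

(** * Duality for the Perron-Frobenius operator *)

Section transfer.
Context {R : realType}.
Notation mu := (@lebesgue_measure R).
Notation I := (unit_itv R).
Notation m := (@leb01 R).
Notation L1 := (LspaceType1 (@leb01 R)).
Implicit Types (u v : L1) (g h : R -> R).

Let mI : measurable I := unit_itvm.

Lemma pairing_indic u (A : set R) : measurable A ->
  pairing u \1_A = \int[mu]_(x in I `&` A) L1repr u x.
Proof.
move=> mA; rewrite Rintegral_mkcondr; apply: eq_Rintegral => x _.
by rewrite indicE patchE; case: (x \in A); rewrite ?mulr1 ?mulr0.
Qed.

(** The sum counts the levels e, 2 e, ... that y reaches, so it is the integer part of y / e. *)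
Lemma layer_cake_approx (e y : R) (N : nat) : 0 < e -> 0 <= y <= N%:R * e ->
  `|y - e * \sum_(j < N) ((j.+1)%:R * e <= y)%R%:R| <= e.
Proof.
move=> e0; elim: N => [|N IH] /andP[y0 yN].
  rewrite big_ord0 mulr0 subr0 ger0_norm//; apply: (le_trans yN).
  by rewrite mul0r ltW.
rewrite big_ord_recr/=; have [yNe|Ney] := leP y (N%:R * e).
  rewrite (_ : (_ <= y) = false) ?addr0 ?IH ?y0//.
  by apply/negbTE; rewrite -ltNge (le_lt_trans yNe)// ltr_pM2r// ltr_nat.
rewrite (eq_bigr (fun=> 1)) => [|j _]; last first.
  rewrite (_ : (_ <= y) = true)//; apply: ltW; apply: le_lt_trans Ney.
  by rewrite ler_pM2r// ler_nat.
rewrite sumr_const card_ord.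
move: yN; rewrite -natr1; case: (_ <= y) => /= yN; rewrite ler_norml; apply/andP; lra.
Qed.

(** For g an indicator this is the defining property of the operator.  Both
    sides are linear in g and continuous for the uniform norm, and a bounded
    function is uniformly close to a combination of indicators of its
    superlevel sets. *)
Lemma pairing_perron_frobenius (f g : R -> R) u : nonsingular f ->
  set_fun I I f -> bounded_measurable g ->
  pairing (perron_frobenius f u) g = pairing u (g \o f).
Proof.
move=> nf fI bg; have [mg [B0 gB0]] := bg; have [mf _] := nf.
have bcomp h : bounded_measurable h -> bounded_measurable (h \o f).
  exact: bounded_measurable_comp.
have indic A : measurable A -> A `<=` I ->
    pairing (perron_frobenius f u) \1_A = pairing u (\1_A \o f).
  move=> mA AI; rewrite pairing_indic// setIidr// /Rintegral.
  have mfA : measurable (I `&` f @^-1` A) by exact: mf.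
  have := perron_frobeniusP u nf; move=> /(_ A mA).
  rewrite (leb01_integralS _ mA AI) (leb01_integralS _ mfA (@subIsetl _ _ _)).
  move=> ->; transitivity (pairing u \1_(I `&` f @^-1` A)).
    by rewrite pairing_indic// setIA setIid.
  apply: pairing_eq => x Ix; rewrite /= !indicE; congr ((nat_of_bool _)%:R).
  by apply/idP/idP => /set_mem xA; apply/mem_set; [case: xA|split].
pose v := perron_frobenius f u.
(* Shifted by B, the function g is nonnegative and at most N levels high. *)
pose B := `|B0|.
have gB x : I x -> `|g x| <= B.
  by move=> Ix; rewrite (le_trans (gB0 x Ix))// ler_norm.
apply/eqP; rewrite -subr_eq0 -normr_le0; apply/ler_addgt0Pl => eps eps0.
rewrite addr0.
pose e := eps / (`|v| + `|u| + 1).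
have D0 : 0 < `|v| + `|u| + 1 by rewrite ltr_wpDl// addr_ge0.
have e0 : 0 < e by rewrite divr_gt0.
pose N := (Num.truncn (2 * B / e)).+1.
have BN : 2 * B <= N%:R * e.
  by rewrite -ler_pdivrMr// ltW// truncnS_gt.
pose A j := I `&` g @^-1` `[(j.+1)%:R * e - B, +oo[.
have mA j : measurable (A j) by apply: mg => //; exact: measurable_itv.
have AI j : A j `<=` I by exact: subIsetl.
have bA j : bounded_measurable (\1_(A j) : R -> R) by exact: bounded_measurable_indic.
pose s x := e * \sum_(j <- index_enum 'I_N) \1_(A j) x - B.
have bsum : bounded_measurable (fun x => \sum_(j <- index_enum 'I_N) \1_(A j) x : R).
  by apply: bounded_measurable_sum.
have bs : bounded_measurable s.
  apply: bounded_measurableB; last exact: bounded_measurable_cst.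
  exact: bounded_measurableZ.
have sg x : I x -> `|g x - s x| <= e.
  move=> Ix; have gBx := gB x Ix; rewrite /s.
  rewrite (eq_bigr (fun j : 'I_N => ((j.+1)%:R * e <= g x + B)%R%:R : R)) => [|j _].
    rewrite opprB addrA.
    apply: layer_cake_approx => //; move: gBx; rewrite ler_norml => /andP[]; lra.
  rewrite indicE; congr ((nat_of_bool _)%:R).
  rewrite -lerBlDr; apply/idP/idP => [/set_mem[_]|xA].
    by rewrite /= in_itv/= andbT.
  by apply/mem_set; split=> //=; rewrite in_itv/= andbT.
have vs : pairing v s = pairing u (s \o f).
  rewrite /s pairingBr//; last 2 first.
  - exact: bounded_measurableZ.
  - exact: bounded_measurable_cst.
  rewrite (pairingBr u (bcomp _ (bounded_measurableZ e bsum)) (bounded_measurable_cst B)).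
  congr (_ - _); last first.
    have -> : pairing v (fun=> B) = pairing v (fun x => B * \1_I x).
      by apply: pairing_eq => x Ix; rewrite indicE mem_set// mulr1.
    rewrite pairingZr; last exact: bounded_measurable_indic.
    rewrite indic// -pairingZr; last exact/bcomp/bounded_measurable_indic.
    by apply: pairing_eq => x Ix; rewrite /= indicE mem_set ?mulr1//; exact: fI.
  rewrite pairingZr// (pairingZr u e (bcomp _ bsum)); congr (_ * _).
  rewrite pairing_sumr//.
  transitivity (\sum_(j < N) pairing u (\1_(A j) \o f)).
    by apply: eq_bigr => j _; rewrite indic.
  exact/esym/(pairing_sumr u _ (fun j : 'I_N => bcomp _ (bA j))).
rewrite (_ : _ - _ = pairing v (fun x => g x - s x) - pairing u (fun x => g (f x) - s (f x))).
  apply: (le_trans (ler_normB _ _)).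
  apply: (@le_trans _ _ (e * `|v| + e * `|u|)).
    rewrite lerD// le_pairing//.
    - exact: bounded_measurableB.
    - by apply: (bcomp (fun x => g x - s x)); exact: bounded_measurableB.
    - by move=> x Ix; apply: sg; exact: fI.
  rewrite -mulrDr /e -mulrA ger_pMr// mulrC ler_pdivrMr// mul1r lerDl; lra.
rewrite pairingBr// (pairingBr u (bcomp _ bg) (bcomp _ bs)) vs.
rewrite /v; ring.
Qed.

End transfer.

(** * Primitives of functions with finitely many discontinuities *)

Section primitives.
Context {R : realType}.
Notation mu := (@lebesgue_measure R).
Notation I := (unit_itv R).
Implicit Types (g h phi : R -> R).

Let mI : measurable I := unit_itvm.

Lemma cvg_sumR (F : set_system R) {FF : Filter F} (J : Type) (s : seq J)
    (h : J -> R -> R) (l : J -> R) : (forall j, h j y @[y --> F] --> l j) ->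
  \sum_(j <- s) h j y @[y --> F] --> \sum_(j <- s) l j.
Proof.
move=> hl; elim: s => [|j s IH].
  by rewrite big_nil; under eq_fun do rewrite big_nil; exact: cvg_cst.
by rewrite big_cons; under eq_fun do rewrite big_cons; exact: cvgD.
Qed.

Lemma invn_lt (e : R) : 0 < e -> exists N : nat, N.+1%:R^-1 < e.
Proof.
move=> e0; exists (Num.truncn e^-1); rewrite invf_plt ?posrE ?ltr0n//.
exact: truncnS_gt.
Qed.

Definition prim0 g x : R := \int[mu]_(t in `[0, x]) g t.

Definition cont_off (T : set R) g :=
  forall x, 0 < x < 1 -> ~ T x -> {for x, continuous g}.

(** Discontinuities cannot be avoided: composing with the maps and
    subtracting cell averages both create finitely many of them. *)
Definition test_fun g := (exists2 T, finite_set T & cont_off T g) /\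
  exists B : R, forall x, I x -> `|g x| <= B.

Lemma finite_closedR (T : set R) : finite_set T -> closed T.
Proof.
move: T; apply/accessible_finite_set_closed/hausdorff_accessible.
exact: Rhausdorff.
Qed.

Lemma finite_measurableR (T : set R) : finite_set T -> measurable T.
Proof.
move=> /finite_set_countable; apply: countable_measurable => t.
exact: measurable_set1.
Qed.

(** The interval minus finitely many points is open, and on a finite set
    every function is measurable. *)
Lemma cont_off_measurable (T : set R) g : finite_set T -> cont_off T g ->
  measurable_fun I g.
Proof.
move=> finT gT.
pose T' := T `|` [set 0; 1].
have finT' : finite_set T' by rewrite finite_setU; split => //; exact: finite_set2.
have oU : open (`]0, 1[%classic `\` T' : set R).
  rewrite setDE; apply: openI; first exact: interval_open.
  by apply: closed_openC; exact: finite_closedR.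
have -> : I = (`]0, 1[%classic `\` T') `|` (I `&` T').
  apply/seteqP; split=> x.
    move=> Ix; have [Tx|nTx] := pselect (T' x); [by right|left; split=> //].
    move: Ix nTx; rewrite /= !in_itv/= => /andP[x0 x1] nTx.
    rewrite !lt_neqAle x0 x1 !andbT; apply/andP; split; apply/eqP => xE.
      by apply: nTx; right; left; rewrite -xE.
    by apply: nTx; right; right; rewrite -xE.
  by move=> [[]|[]//]; rewrite /= !in_itv/= => /andP[/ltW -> /ltW ->].
have finIT : finite_set (I `&` T') by exact: finite_setIr.
apply/measurable_funU.
- by apply: measurableD; [exact: measurable_itv|exact: finite_measurableR].
- exact: finite_measurableR.
split.
  apply: open_continuous_measurable_fun => // x; rewrite inE /= in_itv/= => -[x01 nT].
  by apply: gT => // Tx; apply: nT; left.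
move=> _ Y mY; apply: finite_measurableR.
by apply: sub_finite_set finIT; exact: subIsetl.
Qed.

Lemma test_fun_bounded_measurable g : test_fun g -> bounded_measurable g.
Proof.
by move=> [[T fT gT] gB]; split=> //; exact: cont_off_measurable gT.
Qed.

Lemma prim0_int g x y : bounded_measurable g -> 0 <= x -> x <= y -> y <= 1 ->
  prim0 g y - prim0 g x = \int[mu]_(t in `]x, y]) g t.
Proof.
move=> bg x0 xy y1; rewrite /prim0 Rintegral_itvB//.
apply: integrableS (bounded_measurable_integrable bg) => //.
by move=> t /=; rewrite !in_itv/= => /andP[-> /le_trans]; exact.
Qed.

Lemma prim0_lip g (B : R) x y : bounded_measurable g ->
  (forall x, I x -> `|g x| <= B) -> 0 <= x -> x <= y -> y <= 1 ->
  `|prim0 g y - prim0 g x| <= B * (y - x).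
Proof.
move=> bg gB x0 xy y1; rewrite prim0_int//.
have sub : `]x, y] `<=` I.
  move=> t /=; rewrite !in_itv/= => /andP[xt ty].
  by rewrite (le_trans x0 (ltW xt)) (le_trans ty).
have ig : mu.-integrable `]x, y] (EFin \o g).
  by apply: integrableS (bounded_measurable_integrable bg).
apply: (le_trans (le_normr_Rintegral _ ig)) => //.
have -> : B * (y - x) = \int[mu]_(t in `]x, y]) B.
  rewrite Rintegral_cst//; congr (_ * _).
  rewrite [X in fine X]lebesgue_measure_itv/= lte_fin.
  by case: ltgtP xy => // -> _; rewrite subrr.
apply: le_Rintegral => //.
- exact: integrable_norm.
- apply: integrableS (bounded_measurable_integrable (bounded_measurable_cst B)) => //.
- by move=> t /sub; exact: gB.
Qed.

Lemma prim0_0 g : prim0 g 0 = 0.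
Proof. by rewrite /prim0 set_itv1 Rintegral_set1. Qed.

Lemma prim0_derive g x : bounded_measurable g -> 0 < x < 1 ->
  {for x, continuous g} -> is_derive x 1 (prim0 g) (g x).
Proof.
move=> bg /andP[x0 x1] cg.
have [] := @continuous_FTC1_closed R g 0 x 1 x1 _ x0 cg.
  exact: bounded_measurable_integrable.
by move=> dF F'; apply: DeriveDef => //; rewrite -derive1E.
Qed.

Lemma prim0_continuous g x : bounded_measurable g -> 0 < x < 1 ->
  {for x, continuous (prim0 g)}.
Proof.
move=> bg /andP[x0 x1]; have [_ [B gB]] := bg.
apply/cvgrPdist_le => e e0.
have B0 : 0 < `|B| + 1 by rewrite ltr_wpDl.
near=> y.
have y0 : 0 <= y by near: y; exact: lt_le_nbhsr.
have y1 : y <= 1 by near: y; exact: lt_le_nbhsl.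
apply: (@le_trans _ _ ((`|B| + 1) * `|x - y|)).
  have gB' z : I z -> `|g z| <= `|B| + 1.
    by move=> /gB /le_trans; apply; rewrite (le_trans (ler_norm _))// lerDl.
  have [xy|/ltW yx] := leP x y.
    rewrite distrC; apply: (le_trans (prim0_lip bg gB' (ltW x0) xy y1)).
    by rewrite distrC [`|y - x|]ger0_norm ?subr_ge0.
  apply: (le_trans (prim0_lip bg gB' y0 yx (ltW x1))).
  by rewrite [`|x - y|]ger0_norm ?subr_ge0.
rewrite mulrC -ler_pdivlMr//.
by near: y; apply: cvgr_dist_le; [exact: cvg_id|rewrite divr_gt0].
Unshelve. all: by end_near. Qed.

(** The mean value theorem applies between consecutive exceptional points,
    and continuity joins the pieces. *)
Lemma constant_off_finite (T : seq R) h x y : x <= y ->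
  {in `[x, y], forall z, {for z, continuous h}} ->
  (forall z, x < z < y -> z \notin T -> is_derive z 1 h 0) -> h x = h y.
Proof.
elim: T x y => [|t T IH] x y; rewrite le_eqVlt => /predU1P[->//|xy] ch dh.
  have [z zxy|z zxy|] := @MVT R h (fun=> 0) x y xy.
  - by apply: dh.
  - by apply: continuous_in_subspaceT => w /set_mem; exact: ch.
  - move=> c _; rewrite mul0r => /eqP; rewrite subr_eq0 => /eqP ->//.
have [/andP[xt ty]|nt] := boolP (x < t < y).
  transitivity (h t); apply: IH; try exact: ltW.
  - move=> z; rewrite in_itv/= => /andP[xz zt]; apply: ch.
    by rewrite in_itv/= xz (le_trans zt (ltW ty)).
  - move=> z /andP[xz zt] zT; apply: dh; first by rewrite xz (lt_trans zt).
    by rewrite inE negb_or zT lt_eqF.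
  - move=> z; rewrite in_itv/= => /andP[tz zy]; apply: ch.
    by rewrite in_itv/= zy (le_trans (ltW xt)).
  - move=> z /andP[tz zy] zT; apply: dh; first by rewrite zy (lt_trans xt).
    by rewrite inE negb_or zT gt_eqF.
apply: IH => //; first exact: ltW.
move=> z zxy zT; apply: dh => //; rewrite inE negb_or zT andbT.
by apply: contraNneq nt => <-.
Qed.

(** The function phi is a primitive of g that may jump on S, and has finitely
    many kinks T elsewhere.  The two sets are kept apart because estimates
    depend on the position of the jumps, whereas for the kinks finiteness is
    enough. *)
Definition prim (S : set R) phi g :=
  cont_off S phi /\ exists2 T, finite_set T &
    forall x, 0 < x < 1 -> ~ S x -> ~ T x ->
      is_derive x 1 phi (g x) /\ {for x, continuous g}.

Lemma prim_prim0 (S : set R) phi g x y : bounded_measurable g -> prim S phi g ->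
  0 < x -> x <= y -> y < 1 -> (forall z, x <= z <= y -> ~ S z) ->
  prim0 g y - prim0 g x = phi y - phi x.
Proof.
move=> bg [cphi [T /finite_seqP[s ->] dphi]] x0 xy y1 nS.
have in01 z : x <= z <= y -> 0 < z < 1.
  by move=> /andP[xz zy]; rewrite (lt_le_trans x0)//= (le_lt_trans zy).
suff : (prim0 g - phi) x = (prim0 g - phi) y.
  by rewrite !fctE; lra.
apply: (@constant_off_finite s) => // z.
  rewrite in_itv/= => zxy; apply: continuousB.
    by apply: prim0_continuous => //; exact: in01.
  by apply: cphi; [exact: in01|exact: nS].
move=> /andP[xz zy] zs.
have zxy : x <= z <= y by rewrite !ltW.
have [|//||dz cg] := dphi z; [exact: in01|exact: nS|exact/negP|].
rewrite -(subrr (g z)); apply: is_deriveB.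
exact: prim0_derive (in01 _ zxy) _.
Qed.

(** Up to its ends, an interval free of jumps sees an increment of phi.  The
    ends themselves may be jumps, so the estimate is first made slightly inside
    and then extended, the primitive of g being Lipschitz. *)
Lemma prim_prim0_le (S : set R) phi g (A : R) x y :
  bounded_measurable g -> prim S phi g -> (forall z, I z -> `|phi z| <= A) ->
  0 <= x -> x <= y -> y <= 1 -> (forall z, x < z < y -> ~ S z) ->
  `|prim0 g y - prim0 g x| <= 2 * A.
Proof.
move=> bg pg phiA x0 xy y1 nS; have [_ [B0 gB0]] := bg.
have A0 : 0 <= A by apply: le_trans (phiA 0 _) => //; rewrite /= in_itv/= lexx ler01.
move: xy; rewrite le_eqVlt => /predU1P[->|xy]; first by rewrite subrr normr0 mulr_ge0.
pose B := `|B0| + 1; have Bp : 0 < B by rewrite ltr_wpDl.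
have gB z : I z -> `|g z| <= B.
  by move=> /gB0 /le_trans; apply; rewrite (le_trans (ler_norm _))// lerDl.
apply/ler_addgt0Pl => e e0.
(* Retreating by d at both ends costs 2 B d <= e and leaves x + d <= y - d. *)
pose d := Num.min (e / (2 * B)) ((y - x) / 3).
have d0 : 0 < d.
  by rewrite lt_min !divr_gt0//= ?mulr_gt0// ?subr_gt0.
have dB : 2 * (B * d) <= e.
  by rewrite mulrA -ler_pdivlMl ?mulr_gt0// mulrC ge_min lexx.
have dxy : d <= (y - x) / 3 by rewrite ge_min lexx orbT.
have x'y' : x + d <= y - d by lra.
have := prim_prim0 bg pg (x := x + d) (y := y - d) _ x'y' _ _.
move=> /(_ _)/(_ _)/(_ _) E.
have {E}E : prim0 g (y - d) - prim0 g (x + d) = phi (y - d) - phi (x + d).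
  apply: E; [lra|lra|move=> z /andP[z1 z2]; apply: nS; apply/andP; lra].
have inI z : x <= z <= y -> I z.
  by move=> /andP[? ?]; rewrite /= in_itv/=; apply/andP; lra.
have := prim0_lip bg gB (x := x) (y := x + d) x0.
move=> /(_ ltac:(lra) ltac:(lra)); rewrite ler_norml => /andP[a1 a2].
have := prim0_lip bg gB (x := y - d) (y := y).
move=> /(_ ltac:(lra) ltac:(lra) y1); rewrite ler_norml => /andP[b1 b2].
have := phiA (y - d); rewrite ler_norml => /(_ (inI _ _))/andP[|c1 c2].
  by apply/andP; lra.
have := phiA (x + d); rewrite ler_norml => /(_ (inI _ _))/andP[|e1 e2].
  by apply/andP; lra.
have F1 : B * (x + d - x) = B * d by ring.
have F2 : B * (y - (y - d)) = B * d by ring.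
rewrite F1 in a1 a2; rewrite F2 in b1 b2.
by rewrite ler_norml; apply/andP; lra.
Qed.

End primitives.

(** * Centering on the cells of a grid *)

Section centering.
Context {R : realType}.
Notation mu := (@lebesgue_measure R).
Notation I := (unit_itv R).
Notation L1 := (LspaceType1 (@leb01 R)).
Implicit Types (g h phi : R -> R) (x y : R) (u : L1).

Lemma prim0_integrable g x : bounded_measurable g -> x <= 1 ->
  mu.-integrable `[0, x] (EFin \o g).
Proof.
move=> bg x1; apply: integrableS (bounded_measurable_integrable bg) => //.
by move=> t /=; rewrite !in_itv/= => /andP[-> /le_trans]; exact.
Qed.

Lemma prim0D g h x : bounded_measurable g -> bounded_measurable h -> x <= 1 ->
  prim0 (fun z => g z + h z) x = prim0 g x + prim0 h x.
Proof. by move=> bg bh x1; rewrite /prim0 RintegralD//; exact: prim0_integrable. Qed.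

Lemma prim0Z c g x : bounded_measurable g -> x <= 1 ->
  prim0 (fun z => c * g z) x = c * prim0 g x.
Proof. by move=> bg x1; rewrite /prim0 RintegralZl//; exact: prim0_integrable. Qed.

Lemma prim0B g h x : bounded_measurable g -> bounded_measurable h -> x <= 1 ->
  prim0 (fun z => g z - h z) x = prim0 g x - prim0 h x.
Proof. by move=> bg bh x1; rewrite /prim0 RintegralB//; exact: prim0_integrable. Qed.

Lemma prim0_sum (J : Type) (s : seq J) (h : J -> R -> R) x :
  (forall j, bounded_measurable (h j)) -> x <= 1 ->
  prim0 (fun z => \sum_(j <- s) h j z) x = \sum_(j <- s) prim0 (h j) x.
Proof.
move=> hb x1; elim: s => [|j s IH].
  rewrite big_nil /prim0 (_ : (fun _ => _) = fun=> 0).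
    by rewrite Rintegral_cst// mul0r.
  by apply/funext => z; rewrite big_nil.
rewrite big_cons -IH -prim0D//; last exact: bounded_measurable_sum.
by congr prim0; apply/funext => z; rewrite big_cons.
Qed.

Lemma prim0_indic (a b x : R) : 0 <= a -> a <= b -> 0 <= x ->
  prim0 \1_(`[a, b[%classic) x = Num.min x b - Num.min x a.
Proof.
move=> a0 ab x0; rewrite /prim0 /Rintegral integral_indic//=.
have [xa|ax] := ltP x a.
  rewrite (_ : _ `&` _ = set0).
    by rewrite measure0/= !min_l ?subrr// ?(ltW xa)// (le_trans (ltW xa)).
  apply/seteqP; split=> // z /= [] ; rewrite !in_itv/= => /andP[az _] /andP[_ zx].
  by move: (le_lt_trans zx xa); rewrite ltNge az.
have [xb|bx] := ltP x b.
  rewrite (_ : _ `&` _ = `[a, x]%classic).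
    by rewrite [X in fine X]lebesgue_measure_itv/= lte_fin; case: ltgtP ax => // ->; rewrite subrr.
  apply/seteqP; split=> z /=; rewrite !in_itv/=.
    by move=> [/andP[-> _] /andP[_ ->]].
  by move=> /andP[az zx]; rewrite az zx (le_trans a0 az) (le_lt_trans zx xb).
rewrite (_ : _ `&` _ = `[a, b[%classic).
  by rewrite [X in fine X]lebesgue_measure_itv/= lte_fin; case: ltgtP ab => // ->; rewrite subrr.
apply/seteqP; split=> z /=; rewrite !in_itv/=.
  by move=> [].
by move=> /andP[az zb]; rewrite az zb (le_trans a0 az) (le_trans (ltW zb) bx).
Qed.

Section grid.
Variables (t : nat -> R) (n : nat).
Hypothesis t0 : t 0%N = 0.
Hypothesis tn : t n = 1.
Hypothesis t_lt : forall j, (j < n)%N -> t j < t j.+1.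

Definition cell j : set R := `[t j, t j.+1[%classic.
Definition avg g j : R := (prim0 g (t j.+1) - prim0 g (t j)) / (t j.+1 - t j).
(** The conditional expectation of g given the cells of the grid. *)
Definition cellavg g x := \sum_(j < n) avg g j * (\1_(cell j) x : R).

Lemma grid_le i j : (i <= j)%N -> (j <= n)%N -> t i <= t j.
Proof.
move=> ij; rewrite -(subnK ij); elim: (j - i)%N => [|d IH] dn.
  by rewrite add0n.
rewrite addSn in dn *; apply: (le_trans (IH (ltnW dn))).
by apply/ltW/t_lt.
Qed.

Lemma grid_ge0 j : (j <= n)%N -> 0 <= t j.
Proof. by move=> jn; rewrite -t0 grid_le. Qed.

Lemma grid_le1 j : (j <= n)%N -> t j <= 1.
Proof. by move=> jn; rewrite -tn grid_le. Qed.

Lemma bounded_measurable_cell j : bounded_measurable (\1_(cell j) : R -> R).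
Proof. by apply: bounded_measurable_indic; exact: measurable_itv. Qed.

Lemma bounded_measurable_cellavg g : bounded_measurable (cellavg g).
Proof.
apply: bounded_measurable_sum => j; apply: bounded_measurableZ.
exact: bounded_measurable_cell.
Qed.

(** The centred primitive vanishes at the grid points, so that cells do not
    interact.  Inside a cell, at the fraction th of its length, it is
    (1 - th) times the increment from the left end minus th times the increment
    to the right end. *)
Lemma prim0_cellavg_bound g (A : R) :
  (forall j x, (j < n)%N -> t j <= x <= t j.+1 ->
     `|prim0 g x - prim0 g (t j)| <= A /\ `|prim0 g (t j.+1) - prim0 g x| <= A) ->
  0 <= A ->
  forall x, I x -> `|prim0 g x - \sum_(j < n) avg g j * prim0 \1_(cell j) x| <= A.
Proof.
move=> gA A0 x; rewrite /= in_itv/= => /andP[x0 x1].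
(* Past t m, the first m cells are complete and their sum telescopes. *)
suff H : forall m, (m <= n)%N ->
    (t m <= x -> \sum_(j < m) avg g j * prim0 \1_(cell j) x = prim0 g (t m)) /\
    (x <= t m -> `|prim0 g x - \sum_(j < m) avg g j * prim0 \1_(cell j) x| <= A).
  by apply: (H n (leqnn n)).2; rewrite tn.
elim=> [_|m IH mn].
  rewrite big_ord0 t0 prim0_0; split=> // x00.
  have -> : x = 0 by apply/eqP; rewrite eq_le x0 x00.
  by rewrite prim0_0 subrr normr0.
have [IHa IHb] := IH (ltnW mn); have tm := t_lt mn.
have d0 : 0 < t m.+1 - t m by rewrite subr_gt0.
rewrite big_ord_recr/= prim0_indic ?grid_ge0 ?(ltW tm)// 1?ltnW//.
split=> [tx|xt].
  rewrite IHa; last exact: le_trans (ltW tm) tx.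
  rewrite !min_r//; last exact: le_trans (ltW tm) tx.
  by rewrite /avg divfK ?gt_eqF//; ring.
have [xtm|tmx] := leP x (t m).
  by rewrite !min_l// subrr mulr0 addr0; exact: IHb.
rewrite (IHa (ltW tmx)) (min_l xt).
have [g1 g2] := gA m x mn ltac:(by rewrite (ltW tmx) xt).
pose th := (x - t m) / (t m.+1 - t m).
have thE : th = (x - t m) / (t m.+1 - t m) by [].
clearbody th.
have th0 : 0 <= th by rewrite thE divr_ge0 ?subr_ge0 ?ltW.
have th1 : th <= 1 by rewrite thE ler_pdivrMr// mul1r lerD2r.
rewrite (_ : _ - _ = (1 - th) * (prim0 g x - prim0 g (t m)) -
   th * (prim0 g (t m.+1) - prim0 g x)); last first.
  by rewrite /avg thE; field; rewrite gt_eqF.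
apply: (le_trans (ler_normB _ _)); rewrite !normrM (ger0_norm th0).
rewrite (ger0_norm (_ : 0 <= 1 - th)) ?subr_ge0//.
have := ler_wpM2l th0 g2.
have := ler_wpM2l (_ : 0 <= 1 - th) g1; rewrite subr_ge0 => /(_ th1).
lra.
Qed.

Lemma prim0_sub_cellavg g (A : R) : bounded_measurable g ->
  (forall j x, (j < n)%N -> t j <= x <= t j.+1 ->
     `|prim0 g x - prim0 g (t j)| <= A /\ `|prim0 g (t j.+1) - prim0 g x| <= A) ->
  0 <= A ->
  forall x, I x -> `|prim0 (fun z => g z - cellavg g z) x| <= A.
Proof.
move=> bg gA A0 x Ix; have x1 : x <= 1 by move: Ix; rewrite /= in_itv/= => /andP[].
rewrite prim0B//; last exact: bounded_measurable_cellavg.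
rewrite prim0_sum//; last first.
  by move=> j; apply: bounded_measurableZ; exact: bounded_measurable_cell.
rewrite (eq_bigr (fun j : 'I_n => avg g j * prim0 \1_(cell j) x)); last first.
  by move=> j _; rewrite prim0Z//; exact: bounded_measurable_cell.
exact: prim0_cellavg_bound.
Qed.

Lemma indic_itv_continuous (a b x : R) : x != a -> x != b ->
  {for x, continuous (\1_(`[a, b[%classic) : R -> R)}.
Proof.
move=> xa xb.
have near_a : \forall y \near x, (a <= y) = (a <= x).
  have [ax|xa'|E] := ltgtP a x; last by rewrite E eqxx in xa.
    by apply: filterS (lt_nbhsr ax) => y /ltW.
  by apply: filterS (lt_nbhsl xa') => y ya; apply/negbTE; rewrite -ltNge.
have near_b : \forall y \near x, (y < b) = (x < b).
  have [xb'|bx|E] := ltgtP x b; last by rewrite E eqxx in xb.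
    by apply: filterS (lt_nbhsl xb') => y.
  by apply: filterS (lt_nbhsr bx) => y yb; apply/negbTE; rewrite -leNgt ltW.
have mem y : (y \in `[a, b[%classic) = (a <= y) && (y < b).
  by apply/idP/idP; rewrite inE /= in_itv.
apply: cvg_near_cst; apply: filterS2 near_a near_b => y ya yb.
by rewrite !indicE !mem ya yb.
Qed.

Lemma test_fun_sub_cellavg g : test_fun g -> test_fun (fun z => g z - cellavg g z).
Proof.
move=> tg; have bg := test_fun_bounded_measurable tg.
split; last by have [] := bounded_measurableB bg (bounded_measurable_cellavg g).
have [[T fT cT] _] := tg.
exists (T `|` (t @` `I_n.+1)).
  by rewrite finite_setU; split=> //; apply: finite_image; exact: finite_II.
move=> x x01 nT; apply: cvgB; first by apply: cT => // Tx; apply: nT; left.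
apply: cvg_sumR => j; apply: cvgM; first exact: cvg_cst.
apply: indic_itv_continuous; apply/eqP => xE; apply: nT; right.
  by exists j => //=; rewrite ltnS ltnW.
by exists j.+1 => //=; rewrite ltnS.
Qed.

Lemma pairing_cellavg_le u g : bounded_measurable g ->
  `|pairing u g| <= `|pairing u (fun z => g z - cellavg g z)| +
     \sum_(j < n) `|avg g j| * `|pairing u \1_(cell j)|.
Proof.
move=> bg; have bc := bounded_measurable_cellavg g.
have -> : pairing u g = pairing u (fun z => g z - cellavg g z) + pairing u (cellavg g).
  by rewrite pairingBr// subrK.
apply: (le_trans (ler_normD _ _)); rewrite lerD2l.
rewrite pairing_sumr; last first.
  by move=> j; apply: bounded_measurableZ; exact: bounded_measurable_cell.
apply: (le_trans (ler_norm_sum _ _ _)); apply: ler_sum => j _.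
by rewrite pairingZr ?normrM//; exact: bounded_measurable_cell.
Qed.

End grid.

Lemma finite_grid (T : set R) : finite_set T -> T 0 -> T 1 ->
  exists n t, [/\ t 0%N = 0, t n = 1, forall j, (j < n)%N -> t j < t j.+1 &
    forall j z, (j < n)%N -> t j < z < t j.+1 -> ~ T z].
Proof.
move=> /finite_seqP[s0 ->] T0 T1.
pose s := sort <=%R (undup [seq x <- s0 | 0 <= x <= 1]).
have smem x : (x \in s) = (x \in s0) && (0 <= x <= 1).
  by rewrite mem_sort mem_undup mem_filter andbC.
have s_0 : 0 \in s by rewrite smem (T0 : 0 \in s0) lexx ler01.
have s_1 : 1 \in s by rewrite smem (T1 : 1 \in s0) lexx ler01.
have ss : sorted <%R s by rewrite sort_lt_sorted undup_uniq.
have smono := lt_sorted_ltn_nth 1 ss.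
pose t := nth 1 s; pose n := (size s).-1.
have size0 : (0 < size s)%N by case: (s) s_0.
have nS : n.+1 = size s by rewrite prednK.
have tin j : (j < size s)%N -> t j \in s by move=> js; exact: mem_nth.
have t01 j : (j < size s)%N -> 0 <= t j <= 1.
  by move=> /tin; rewrite smem => /andP[].
exists n, t; split.
- have i0 : (index (0%R : R) s < size s)%N by rewrite index_mem.
  apply/eqP; rewrite eq_le; have /andP[-> _] := t01 0%N size0; rewrite andbT.
  rewrite -[leRHS](nth_index 1 s_0) leNgt; apply/negP => H.
  by move: (H); rewrite smono ?inE.
- have i1 : (index (1%R : R) s < size s)%N by rewrite index_mem.
  apply/eqP; rewrite eq_le; have /andP[_ ->] := t01 n (eq_leq nS).
  rewrite -[leLHS](nth_index 1 s_1) leNgt; apply/negP => H.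
  have nin : (n < size s)%N by rewrite -nS.
  move: H; rewrite /t smono ?inE// => H.
  by move: i1; rewrite -nS ltnS leqNgt H.
- move=> j jn; rewrite smono ?inE -?nS//; exact: ltnW.
- move=> j z jn /andP[jz zj] /= zs0.
  have j1 : (j.+1 < size s)%N by rewrite -nS.
  have zs : z \in s.
    rewrite smem zs0/=; apply/andP; split.
      by apply: le_trans (ltW jz); have /andP[] := t01 j (ltnW j1).
    by apply: (le_trans (ltW zj)); have /andP[] := t01 j.+1 j1.
  have iz : (index z s < size s)%N by rewrite index_mem.
  have h1 : (j < index z s)%N by rewrite -smono ?inE ?nth_index// ltnW.
  have h2 : (index z s < j.+1)%N by rewrite -smono ?inE ?nth_index.
  by move: h2; rewrite ltnS leqNgt h1.
Qed.

(** A dual form of: the total variation of u is at most K.  For u a step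
    function the pairing is a sum by parts of the primitive of g against the
    jumps of u.  Stated by duality, the property passes to L^1 limits and can be
    transported by adjoint operators. *)
Definition var_le u (K : R) := forall g (A : R), test_fun g ->
  (forall x, I x -> `|prim0 g x| <= A) -> `|pairing u g| <= K * A.

Lemma var_le_mono u (K K' : R) : K <= K' -> var_le u K -> var_le u K'.
Proof.
move=> KK' uK g A tg gA; apply: (le_trans (uK g A tg gA)).
apply: ler_wpM2r => //; apply: (le_trans (normr_ge0 _) (gA 0 _)).
by rewrite /= in_itv/= lexx ler01.
Qed.

End centering.

(** * Completeness of the space of integrable classes *)

Section completeness.
Context {R : realType}.
Notation mu := (@lebesgue_measure R).
Notation I := (unit_itv R).
Notation L1 := (LspaceType1 (@leb01 R)).
Implicit Types (g h phi : R -> R) (x y : R) (u : L1).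

Let mI : measurable (I : set (measurableTypeR R)) := unit_itvm.

Lemma L1reprB (u v : L1) :
  {ae mu, forall x, I x -> L1repr (u - v) x = L1repr u x - L1repr v x}.
Proof.
rewrite -scaleN1r; apply: lebesgue_aeS2 (L1reprD u (-1 *: v)) (L1reprZ (-1) v).
by move=> x E1 E2 Ix; rewrite E1// E2// mulN1r.
Qed.

Lemma L1normB_integral (u v : L1) :
  `|u - v| = \int[mu]_(x in I) `|L1repr u x - L1repr v x|.
Proof.
rewrite (L1norm_ae (L1reprB u v))//.
by apply: measurable_funB; exact: L1repr_measI.
Qed.

Lemma L1normB_eintegral (u v : L1) :
  (`|u - v|%:E = \int[mu]_(x in I) `|L1repr u x - L1repr v x|%:E)%E.
Proof.
rewrite L1normB_integral /Rintegral fineK//.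
apply: integrable_fin_num => //.
apply: integrable_norm.
have := integrableB mI (L1repr_int u) (L1repr_int v).
by apply: eq_integrable => // x _; rewrite /= EFinB.
Qed.

(** The increments are summable in norm, so almost everywhere their sum G is
    finite and the functions converge, and |F 0| + G dominates them all. *)
Lemma riesz_fischer (a : nat -> L1) : (forall n, `|a n.+1 - a n| <= 2^-1 ^+ n) ->
  exists u, `|a n - u| @[n --> \oo] --> 0.
Proof.
move=> a_cauchy.
pose F n x : R := L1repr (a n) x.
pose d n x : R := `|F n.+1 x - F n x|.
have mF n : measurable_fun I (F n) by exact: L1repr_measI.
have md n : measurable_fun I (fun x => (d n x)%:E).
  by apply/measurable_EFinP; apply: measurableT_comp => //; exact: measurable_funB.
have d0 n x : (0 <= (d n x)%:E)%E by rewrite lee_fin; exact: normr_ge0.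
pose G x : \bar R := (\sum_(0 <= n <oo) (d n x)%:E)%E.
have mG : measurable_fun I G by apply: ge0_emeasurable_sum.
have G0 x : (0 <= G x)%E by apply: nneseries_ge0.
have intG : (\int[mu]_(x in I) G x <= 2%:E)%E.
  rewrite integral_nneseries//.
  apply: lime_le; first by apply: is_cvg_nneseries => n _ _; exact: integral_ge0.
  apply: nearW => n; apply: (@le_trans _ _ (\sum_(0 <= i < n) (2^-1 ^+ i)%:E)%E).
    by apply: lee_sum => i _; rewrite -L1normB_eintegral lee_fin.
  rewrite sumEFin lee_fin.
  have -> : \sum_(0 <= i < n) 2^-1 ^+ i = 2 - 2 * 2^-1 ^+ n :> R.
    elim: n => [|n IH]; first by rewrite big_nil expr0; ring.
    rewrite big_nat_recr//= IH exprS; set X := 2^-1 ^+ n; by field.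
  have X0 : 0 <= 2^-1 ^+ n :> R by rewrite exprn_ge0// invr_ge0.
  lra.
have iG : mu.-integrable I G.
  apply/integrableP; split=> //; under eq_integral do rewrite gee0_abs//.
  by apply: (le_lt_trans intG); rewrite ltry.
have Gfin := integrable_ae mI iG.
pose H x : \bar R := limn_esup (fun n => (F n x)%:E).
have mH : measurable_fun I H.
  by apply: measurable_fun_limn_esup => n; apply/measurable_EFinP.
have FH : {ae mu, forall x, I x -> (fun n => (F n x)%:E) @ \oo --> H x}.
  apply: lebesgue_aeS Gfin => x Gx Ix.
  have cd : cvgn (series (fun n => d n x)).
    apply: nnseries_is_cvg; first by move=> n; rewrite /d.
    by move: (Gx Ix); rewrite fin_numElt => /andP[].
  have cF : cvgn (fun n => F n x).
    have : cvgn (series (telescope (fun n => F n x))).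
      by apply: normed_cvg; exact: cd.
    rewrite telescopeK => /cvg_ex[l /= Fl].
    apply/cvg_ex; exists (l + F 0%N x).
    have : F n x - F 0%N x + F 0%N x @[n --> \oo] --> l + F 0%N x.
      by apply: cvgD => //; exact: cvg_cst.
    by under eq_fun do rewrite subrK.
  have cFE : cvgn (fun n => (F n x)%:E).
    by move/cvg_ex: cF => [l Fl]; apply/cvg_ex; exists l%:E; apply: cvg_EFin => //; exact: nearW.
  by rewrite /H is_cvg_limn_esupE.
pose B x : \bar R := (`|F 0%N x|%:E + G x)%E.
have iB : mu.-integrable I B.
  by apply: integrableD => //; exact: L1repr_int_norm.
have FB : {ae mu, forall x n, I x -> (`|(F n x)%:E| <= B x)%E}.
  exists set0; split => // x /= nP; apply: nP => n Ix.
  apply: (@le_trans _ _ (`|F 0%N x|%:E + \sum_(0 <= i < n) (d i x)%:E)%E).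
    rewrite sumEFin -EFinD lee_fin.
    elim: n => [|n IH]; first by rewrite big_nil addr0.
    rewrite big_nat_recr//= addrA; apply: (@le_trans _ _ (`|F n x| + d n x)); last first.
      by rewrite lerD2r.
    by rewrite /d -[X in `|X| <= _](subrKC (F n x)) ler_normD.
  by rewrite leeD2l//; apply: nneseries_lim_ge.
have mFE n : measurable_fun I (fun x => (F n x)%:E) by exact/measurable_EFinP.
have [iH cvg0 _] := dominated_convergence mI mFE mH FH iB FB.
have iHr : mu.-integrable I (EFin \o (fine \o H)).
  apply/integrableP; split; first by apply/measurable_EFinP; exact: measurableT_comp.
  have /integrableP[_] := iH; apply: le_lt_trans; apply: ge0_le_integral => //.
  - by apply: measurableT_comp => //; apply/measurable_EFinP; exact: measurableT_comp.
  - by apply: measurableT_comp.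
  - by move=> x _ /=; case: (H x) => //=; rewrite normr0 leey.
have [u uH] := L1_of_integrable iHr.
exists u.
have Hfin := integrable_ae mI iH.
have normE n : `|a n - u|%:E = (\int[mu]_(x in I) `|(F n x)%:E - H x|)%E.
  rewrite L1normB_eintegral; apply: ae_eq_integral => //.
  - apply/measurable_EFinP; apply: measurableT_comp => //.
    by apply: measurable_funB => //; exact: L1repr_measI.
  - by apply: measurableT_comp => //; exact: (emeasurable_funB (mFE n) mH).
  apply: lebesgue_aeS2 uH Hfin => x ux Hx Ix; rewrite ux//=.
  by rewrite -[X in (_ = `|_ - X|)%E]fineK ?Hx.
have : (`|a n - u|%:E)%E @[n --> \oo] --> 0%E.
  by under eq_fun do rewrite normE; exact: cvg0.
by move/fine_cvg.
Qed.

End completeness.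

(** * Compactness of balls of bounded variation *)

Section compactness.
Context {R : realType}.
Notation mu := (@lebesgue_measure R).
Notation I := (unit_itv R).
Notation L1 := (LspaceType1 (@leb01 R)).
Implicit Types (g h phi : R -> R) (x y : R) (u : L1).

Let mI : measurable (I : set (measurableTypeR R)) := unit_itvm.

Lemma continuous_bounded g : continuous g -> exists B : R, forall x, I x -> `|g x| <= B.
Proof.
move=> cg.
have cI : compact I by exact: segment_compact.
have /compact_bounded[M [_ HM]] : compact (g @` I).
  by apply: continuous_compact => //; exact: continuous_subspaceT.
by exists (M + 1) => x Ix; apply: HM; [rewrite ltrDl|exists x].
Qed.

Lemma continuous_test_fun g : continuous g -> test_fun g.
Proof.
move=> cg; split; last exact: continuous_bounded.
by exists set0 => // x _ _; exact: cg.
Qed.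

Lemma L1_continuous_approx u (e : R) : 0 < e ->
  exists2 c : R -> R, continuous c & \int[mu]_(x in I) `|L1repr u x - c x| <= e.
Proof.
move=> e0.
have Ifin : (mu I < +oo)%E.
  by rewrite [X in (X < _)%E]lebesgue_unit_itv ltry.
have [c_ [cc ic cvgc]] := approximation_continuous_integrable mI Ifin (L1repr_int u).
have := cvgc; move=> /fine_cvgP[_ /cvgrPdist_le /(_ e e0)[n _ /(_ n (leqnn n))]].
rewrite /= sub0r normrN => cn; exists (c_ n); first exact: cc.
by apply: le_trans cn; rewrite ler_norm.
Qed.

(** If c is continuous and close to u, then c / (|c| + e) is a continuous
    substitute for the sign of u. *)
Lemma continuous_sign u (e : R) : 0 < e -> exists2 s : R -> R, continuous s &
  (forall x, `|s x| <= 1) /\ `|u| <= pairing u s + 3 * e.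
Proof.
move=> e0; have [c cc ce] := L1_continuous_approx u e0.
pose M x := `|c x| + e.
have M0 x : 0 < M x by rewrite ltr_wpDl.
pose s x := c x / M x.
have s1 x : `|s x| <= 1.
  by rewrite /s normrM normfV (gtr0_norm (M0 x)) ler_pdivrMr// mul1r lerDl ltW.
have cs : continuous s.
  move=> x; apply: cvgM; first exact: cc.
  apply: cvgV; first by rewrite gt_eqF.
  by apply: cvgD; [apply: cvg_norm; exact: cc|exact: cvg_cst].
exists s => //; split=> //.
have ts := continuous_test_fun cs; have bs := test_fun_bounded_measurable ts.
have bc := test_fun_bounded_measurable (continuous_test_fun cc).
have iuc : mu.-integrable I (EFin \o (fun x => `|L1repr u x - c x|)%R).
  apply: integrable_norm.
  have := integrableB mI (L1repr_int u) (bounded_measurable_integrable bc).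
  by apply: eq_integrable => // x _; rewrite /= EFinB.
have icst (a : R) : mu.-integrable I (EFin \o (fun=> a)).
  by apply: bounded_measurable_integrable; exact: bounded_measurable_cst.
have iup := pairing_integrable u bs.
have iuc2 : mu.-integrable I (EFin \o (fun x => `|L1repr u x - c x| * 2)%R).
  exact: bounded_measurable_integrableM iuc (bounded_measurable_cst 2).
have : `|u| <= \int[mu]_(x in I) (L1repr u x * s x + (`|L1repr u x - c x| * 2 + e)).
  rewrite L1norm_integral; apply: le_Rintegral => //.
  - exact: L1repr_int_norm.
  - have := integrableD mI iup (integrableD mI iuc2 (icst e)).
    by apply: eq_integrable => // x _.
  move=> x _; set a := L1repr u x.
  have h1 : `|a| <= `|a - c x| + `|c x|.
    by rewrite -[X in `|X| <= _](subrK (c x)) ler_normD.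
  have h2 : `|c x| <= c x * s x + e.
    rewrite -lerBlDr /s mulrA -expr2 -real_normK ?num_real// ler_pdivlMr// /M.
    by have := normr_ge0 (c x); nra.
  have h3 : (c x - a) * s x <= `|a - c x|.
    apply: (le_trans (ler_norm _)); rewrite normrM distrC -[leRHS]mulr1.
    by apply: ler_wpM2l.
  have h4 : c x * s x = a * s x + (c x - a) * s x by ring.
  lra.
move=> /le_trans; apply.
rewrite RintegralD//; last first.
  by have := integrableD mI iuc2 (icst e); apply: eq_integrable.
rewrite RintegralD// RintegralZr// Rintegral_cst//.
have -> : fine (mu I) = 1.
  by rewrite [X in fine X]lebesgue_unit_itv.
rewrite /pairing; lra.
Qed.

Definition ugrid (M j : nat) : R := j%:R / M%:R.

(** Centred on cells of length 1/M, a function bounded by 1 has a primitive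
    bounded by 1/M and averages bounded by 1.  This is applied to a continuous
    substitute for the sign of u. *)
Lemma L1norm_le_cells u (K : R) (M : nat) : (0 < M)%N -> var_le u K ->
  `|u| <= K / M%:R + \sum_(j < M) `|pairing u \1_(cell (ugrid M) j)|.
Proof.
move=> M0 uK.
have MR : 0 < M%:R :> R by rewrite ltr0n.
have t0 : ugrid M 0 = 0 by rewrite /ugrid mul0r.
have tM : ugrid M M = 1 by rewrite /ugrid divff// gt_eqF.
have tS j : ugrid M j.+1 = ugrid M j + M%:R^-1 by rewrite /ugrid -natr1 mulrDl mul1r.
have t_lt j : (j < M)%N -> ugrid M j < ugrid M j.+1.
  by rewrite tS ltrDl invr_gt0.
apply/ler_addgt0Pl => e e0.
have e3 : 0 < e / 3 by rewrite divr_gt0.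
have [s cs [s1 us]] := continuous_sign u e3.
have ts := continuous_test_fun cs; have bs := test_fun_bounded_measurable ts.
have lip x y : 0 <= x -> x <= y -> y <= 1 -> `|prim0 s y - prim0 s x| <= y - x.
  by move=> x0 xy y1; rewrite -[leRHS]mul1r; apply: prim0_lip => // z _.
have Mi : 0 <= M%:R^-1 :> R by rewrite invr_ge0 ltW.
have cells j x : (j < M)%N -> ugrid M j <= x <= ugrid M j.+1 ->
     `|prim0 s x - prim0 s (ugrid M j)| <= M%:R^-1 /\
     `|prim0 s (ugrid M j.+1) - prim0 s x| <= M%:R^-1.
  move=> jm /andP[jx xj].
  have tj0 := grid_ge0 t0 t_lt (ltnW jm).
  have tj1 := grid_le1 tM t_lt jm.
  have E := tS j.
  split; (apply: le_trans; first apply: lip); lra.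
have H1 := pairing_cellavg_le (ugrid M) M u bs.
have H2 := uK _ _ (test_fun_sub_cellavg (ugrid M) M ts) (prim0_sub_cellavg t0 tM t_lt bs cells Mi).
apply: (le_trans us); rewrite addrC.
rewrite [X in X + _](_ : _ = e); last by field.
rewrite lerD2l; apply: (le_trans (ler_norm _)); apply: (le_trans H1).
apply: lerD => //; apply: ler_sum => j _.
rewrite -[leRHS]mul1r; apply: ler_wpM2r => //.
have dj : 0 < ugrid M j.+1 - ugrid M j by rewrite subr_gt0 t_lt.
rewrite /avg normrM normfV (gtr0_norm dj) ler_pdivrMr// mul1r.
apply: lip.
- exact: (grid_ge0 t0 t_lt (ltnW (ltn_ord j))).
- exact/ltW/t_lt.
- exact: (grid_le1 tM t_lt (ltn_ord j)).
Qed.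

Lemma var_leB u v (K : R) : var_le u K -> var_le v K -> var_le (u - v) (2 * K).
Proof.
move=> uK vK g A tg gA; rewrite pairingBl; last exact: test_fun_bounded_measurable.
apply: (le_trans (ler_normB _ _)).
by rewrite -mulrA mulr_natl mulr2n lerD ?uK ?vK.
Qed.

Definition var_ball (r K : R) : set L1 := [set u | `|u| <= r /\ var_le u K].

(** The previous estimate makes the ball totally bounded: up to K/M the norm
    is controlled by M bounded coordinates, which converge along an
    ultrafilter.  The limit exists by completeness and stays in the ball
    because both constraints are closed. *)
Lemma compact_var_ball (r K : R) : compact (var_ball r K).
Proof.
rewrite compact_ultra => U UU UF.
have PU : ProperFilter U by exact: ultra_proper.
have small (e : R) : 0 < e -> exists a : L1, var_ball r K a /\ \forall u \near U, `|u - a| <= e.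
  move=> e0.
  have [M M0 KM] : exists2 M : nat, (0 < M)%N & 2 * K / M%:R <= e / 2.
    exists (Num.truncn (2 * `|K| / (e / 2))).+1 => //.
    rewrite ler_pdivrMr ?ltr0n// [leRHS]mulrC -ler_pdivrMr ?divr_gt0//.
    apply: ltW; apply: le_lt_trans (truncnS_gt _).
    by rewrite ler_pM2r ?invr_gt0 ?divr_gt0// ler_pM2l// ler_norm.
  have bc j : bounded_measurable (\1_(cell (ugrid M) j) : R -> R).
    exact: bounded_measurable_cell.
  have e1 : 0 < e / (4 * M%:R) by rewrite divr_gt0// mulr_gt0// ltr0n.
  have coord j : exists l : R, \forall u \near U, `|pairing u \1_(cell (ugrid M) j) - l| <= e / (4 * M%:R).
    pose phi u := pairing u \1_(cell (ugrid M) j).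
    have phir : U [set u | `[- r, r]%classic (phi u)].
      apply: filterS UF => u [ur _]; rewrite /= in_itv/= -ler_norml.
      apply: le_trans ur; rewrite -[leRHS]mul1r; apply: le_pairing => // x _.
      by rewrite indicE; case: (_ \in _); rewrite ?normr1 ?normr0.
    have cr : compact (`[- r, r]%classic : set R) by exact: segment_compact.
    have [l [_ clus]] := cr _ (fmap_proper_filter phi PU) phir.
    exists l; have [//|nU] := in_ultra_setVsetC [set u | `|phi u - l| <= e / (4 * M%:R)] UU.
    (* Otherwise the complement is in the ultrafilter, against l being a
       cluster point of the coordinate. *)
    pose A := [set z : R | ~ (`|z - l| <= e / (4 * M%:R))].
    have [z [Az]] := clus A _ nU (nbhsx_ballx l _ e1).
    by rewrite /ball/= distrC => /ltW.
  have /boolp.choice[l lP] := coord.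
  have near_all : \forall u \near U, forall j : 'I_M,
      `|pairing u \1_(cell (ugrid M) j) - l j| <= e / (4 * M%:R).
    by apply: filter_forall => j; exact: lP.
  have [a [aF al]] := filter_ex (filterI UF near_all).
  exists a; split=> //.
  apply: filterS2 UF near_all => u [ur uK] ul.
  apply: (le_trans (L1norm_le_cells M0 (var_leB uK aF.2))).
  rewrite [leRHS](splitr e); apply: lerD => //.
  apply: (@le_trans _ _ (\sum_(j < M) (e / (2 * M%:R)))).
    apply: ler_sum => j _; rewrite pairingBl//.
    rewrite (_ : _ - _ = (pairing u \1_(cell (ugrid M) j) - l j) -
      (pairing a \1_(cell (ugrid M) j) - l j)); last by ring.
    apply: (le_trans (ler_normB _ _)).
    apply: (le_trans (lerD (ul j) (al j))).
    rewrite le_eqVlt; apply/orP; left; apply/eqP; field.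
    by rewrite pnatr_eq0 -lt0n.
  rewrite sumr_const card_ord -[_ *+ M]mulr_natr le_eqVlt; apply/orP; left; apply/eqP; field.
  by rewrite pnatr_eq0 -lt0n.
have /boolp.choice[a aP] : forall n, exists a : L1, var_ball r K a /\
    \forall u \near U, `|u - a| <= 2^-1 ^+ n.+1.
  by move=> n; apply: small; rewrite exprn_gt0// invr_gt0.
have h1 : 0 < 2^-1 :> R by rewrite invr_gt0.
have acauchy n : `|a n.+1 - a n| <= 2^-1 ^+ n.
  have [u [u1 u2]] := filter_ex (filterI (aP n).2 (aP n.+1).2).
  rewrite (_ : a n.+1 - a n = (u - a n) - (u - a n.+1)); last first.
    by rewrite opprB [RHS]addrC addrA subrK.
  apply: (le_trans (ler_normB _ _)); apply: (le_trans (lerD u1 u2)).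
  rewrite !exprS; have := exprn_gt0 n h1; set X := 2^-1 ^+ n => X0; lra.
have [w wlim] := riesz_fischer acauchy.
have Uw : U --> w.
  apply/cvgrPdist_le => e e0.
  have e2 : 0 < e / 2 by rewrite divr_gt0.
  move/cvgrPdist_le: (wlim) => /(_ _ e2)[N1 _ HN1].
  have half : `|2^-1 : R| < 1 by rewrite ger0_norm ?invr_ge0// invf_lt1 ?ltr1n.
  have := cvg_expr half; move/cvgrPdist_le => /(_ _ e2)[N2 _ HN2].
  pose n := maxn N1 N2.
  have b1 := HN1 n (leq_maxl _ _); have b2 := HN2 n.+1 (leqW (leq_maxr _ _)).
  have [_ un] := aP n.
  apply: filterS un => u un.
  rewrite (_ : w - u = - (u - a n) - (a n - w)); last first.
    by rewrite !opprB [RHS]addrC addrA subrK.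
  apply: (le_trans (ler_normB _ _)); rewrite normrN.
  move: b1 b2; rewrite /= !sub0r !normrN normr_id => b1.
  rewrite (ger0_norm (exprn_ge0 _ (ltW h1))) => b2.
  rewrite (splitr e) lerD//; exact: le_trans un b2.
exists w; split=> //.
have near_w (e : R) : 0 < e -> exists u : L1, var_ball r K u /\ `|w - u| <= e.
  move=> e0; move/cvgrPdist_le: Uw => /(_ e e0) Uwe.
  by have [u [uF ue]] := filter_ex (filterI UF Uwe); exists u.
split.
  apply/ler_addgt0Pl => e e0; have [u [[ur _] ue]] := near_w e e0.
  by rewrite -(subrK u w) (le_trans (ler_normD _ _))// lerD.
move=> g A tg gA; have [_ [B gB]] := tg.
have bg := test_fun_bounded_measurable tg.
apply/ler_addgt0Pl => e e0.
have B0 : 0 < `|B| + 1 by rewrite ltr_wpDl.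
have [|u [[_ uK] ue]] := near_w (e / (`|B| + 1)); first by rewrite divr_gt0.
rewrite -(subrK u w) pairingDl// (le_trans (ler_normD _ _))// lerD//; last exact: uK.
have : `|pairing (w - u) g| <= (`|B| + 1) * `|w - u|.
  apply: le_pairing => // x Ix; apply: (le_trans (gB x Ix)).
  by rewrite (le_trans (ler_norm _))// lerDl.
move=> /le_trans; apply.
by rewrite mulrC -ler_pdivlMr.
Qed.

End compactness.

(** * Density of bounded variation *)

Section density.
Context {R : realType}.
Notation mu := (@lebesgue_measure R).
Notation I := (unit_itv R).
Notation L1 := (LspaceType1 (@leb01 R)).
Implicit Types (g h phi : R -> R) (x y : R) (u : L1).

Let mI : measurable (I : set (measurableTypeR R)) := unit_itvm.

Lemma L1_of_bounded h : bounded_measurable h ->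
  exists u : L1, {ae mu, forall x, I x -> L1repr u x = h x}.
Proof. by move=> bh; apply: L1_of_integrable; exact: bounded_measurable_integrable. Qed.

(** The interval may stick out of [0,1] on the right, which happens for the
    last cell of a grid covering the point 1. *)
Lemma Rintegral_indic_itv g (a b A : R) : bounded_measurable g ->
  (forall x, I x -> `|prim0 g x| <= A) -> 0 <= a -> a <= 1 -> a <= b ->
  `|\int[mu]_(x in I) (\1_(`[a, b[%classic) x * g x)| <= 2 * A.
Proof.
move=> bg gA a0 a1 ab.
pose c := Num.min b 1.
have ac : a <= c by rewrite le_min ab.
have c1 : c <= 1 by rewrite ge_min lexx orbT.
have Ia : I a by rewrite /= in_itv/= a0.
have Ic : I c by rewrite /= in_itv/= (le_trans a0 ac).
rewrite (_ : \int[mu]_(x in I) _ = prim0 g c - prim0 g a).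
  by apply: (le_trans (ler_normB _ _)); rewrite mulr_natl mulr2n lerD ?gA.
have igac : mu.-integrable `[a, c] (EFin \o g).
  apply: integrableS (bounded_measurable_integrable bg) => //.
  move=> t /=; rewrite !in_itv/= => /andP[at' tc].
  by rewrite (le_trans a0 at') (le_trans tc).
have sub (J : set R) : measurable J -> J `<=` `[a, c] -> mu.-integrable J (EFin \o g).
  by move=> mJ Jac; apply: integrableS igac.
rewrite prim0_int// Rintegral_itv_obnd_cbnd; last first.
  by apply: sub => // t /=; rewrite !in_itv/= => /andP[/ltW -> ->].
transitivity (\int[mu]_(x in I `&` `[a, b[%classic) g x).
  rewrite Rintegral_mkcondr; apply: eq_Rintegral => x _.
  by rewrite patchE indicE; case: (_ \in _); rewrite ?mul1r ?mul0r.
have [b1|b1] := leP b 1.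
  have cb : c = b by rewrite /c min_l.
  rewrite (_ : _ `&` _ = `[a, c[%classic); last first.
    rewrite cb; apply/seteqP; split=> x /=; rewrite !in_itv/=; first by move=> [].
    by move=> /andP[ax xb]; rewrite ax xb (le_trans a0 ax) (le_trans (ltW xb)).
  rewrite Rintegral_itv_bndo_bndc//.
  by apply: sub => // t /=; rewrite !in_itv/= => /andP[-> /ltW ->].
have cb : c = 1 by rewrite /c min_r// ltW.
congr (Rintegral _ _ _); rewrite cb.
apply/seteqP; split=> x /=; rewrite !in_itv/=.
  by move=> [/andP[_ ->] /andP[-> _]].
by move=> /andP[ax x1]; rewrite ax x1 (le_trans a0 ax) (le_lt_trans x1).
Qed.

Lemma uniform_continuity_itv g (e : R) : continuous g -> 0 < e ->
  exists2 M : nat, (0 < M)%N &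
    forall x y, I x -> `|x - y| <= M%:R^-1 -> `|g x - g y| <= e.
Proof.
move=> cg e0; have cI : compact I by exact: segment_compact.
have /compact_near_coveringP := cI.
move=> /(_ nat \oo (fun n x => forall y, `|x - y| <= n.+1%:R^-1 -> `|g x - g y| <= e) _).
case.
  move=> x Ix; have e2 : 0 < e / 2 by rewrite divr_gt0.
  have /cvgrPdist_le/(_ _ e2)/nbhs_ballP[d /= d0 dP] := cg x.
  have d2 : 0 < d / 2 by rewrite divr_gt0.
  have [N Nd] := invn_lt d2.
  exists (ball x (d / 2), [set n | (N <= n)%N]) => /=.
    by split; [exact: nbhsx_ballx|exact: nbhs_infty_ge].
  move=> [z n] [/= xz Nn] y zy.
  have nd : n.+1%:R^-1 < d / 2.
    apply: le_lt_trans Nd; rewrite lef_pV2 ?posrE ?ltr0n//.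
    by rewrite ler_nat.
  have xz' : `|x - z| < d / 2 by exact: xz.
  have h1 : `|g x - g z| <= e / 2.
    by apply: dP; rewrite /ball/=; apply: (lt_trans xz'); lra.
  have h2 : `|g x - g y| <= e / 2.
    apply: dP; rewrite /ball/= (_ : x - y = (x - z) + (z - y)); last by ring.
    have zy' := le_lt_trans zy nd.
    by apply: (le_lt_trans (ler_normD _ _)); lra.
  rewrite (_ : g z - g y = (g x - g y) - (g x - g z)); last by ring.
  by apply: (le_trans (ler_normB _ _)); lra.
by move=> N _ /(_ N (leqnn N)) NP; exists N.+1 => // x y Ix; exact: (NP x Ix).
Qed.

(** A continuous function close to u is close to a step function, and a step
    function is paired with g through finitely many increments of the primitive
    of g. *)
Lemma var_le_dense u (e : R) : 0 < e ->
  exists v : L1, exists2 K : R, var_le v K & `|u - v| <= e.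
Proof.
move=> e0; have e2 : 0 < e / 2 by rewrite divr_gt0.
have [c cc uc] := L1_continuous_approx u e2.
have [M M0 cM] := uniform_continuity_itv cc e2.
have MR : 0 < M%:R :> R by rewrite ltr0n.
pose st x : R := \sum_(j < M.+1) c (ugrid M j) * (\1_(cell (ugrid M) j) x : R).
have b1 (j : nat) : bounded_measurable (\1_(cell (ugrid M) j) : R -> R).
  exact: bounded_measurable_cell.
have bst : bounded_measurable st.
  by apply: bounded_measurable_sum => j; exact: bounded_measurableZ.
have tS (j : nat) : ugrid M j.+1 = ugrid M j + M%:R^-1 :> R by rewrite /ugrid -natr1 mulrDl mul1r.
have stE x : I x -> `|c x - st x| <= e / 2.
  rewrite /= in_itv/= => /andP[x0 x1].
  pose j0 := Num.truncn (x * M%:R).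
  have xM0 : 0 <= x * M%:R by rewrite mulr_ge0// ltW.
  have j0M : (j0 < M.+1)%N.
    rewrite ltnS -(ler_nat R); apply: (@le_trans _ _ (x * M%:R)).
      by rewrite truncn_le.
    by rewrite ler_piMl// ltW.
  have memE (j : nat) : (x \in cell (ugrid M) j) = (j == j0).
    rewrite [RHS]eq_sym truncn_eq// -ler_pdivrMr// -ltr_pdivlMr//.
    by apply/idP/idP; rewrite inE /cell /= in_itv.
  rewrite /st (bigD1 (Ordinal j0M))//= indicE memE eqxx mulr1.
  rewrite big1 ?addr0; last first.
    move=> j jj0; rewrite indicE memE; have -> : (j == j0 :> nat) = false.
      by apply/negbTE; apply: contra jj0 => /eqP E; apply/eqP/val_inj.
    by rewrite mulr0.
  apply: cM; first by rewrite /= in_itv/= x0.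
  have : x \in cell (ugrid M) j0 by rewrite memE.
  rewrite inE /cell /= in_itv/= tS => /andP[l1 l2].
  have Mi : 0 <= M%:R^-1 :> R by rewrite invr_ge0 ltW.
  change (`|x - ugrid M j0| <= M%:R^-1); move: l1 l2; set tj := ugrid M j0 => l1 l2.
  by rewrite ler_norml; apply/andP; lra.
have [v vst] := L1_of_bounded bst.
exists v, (\sum_(j < M.+1) `|c (ugrid M j)| * 2).
  move=> g A tg gA; have bg := test_fun_bounded_measurable tg.
  have [one oneE] := L1_of_bounded (bounded_measurable_cst (1 : R)).
  have mst : measurable_fun I st by have [] := bst.
  have pone h : bounded_measurable h -> pairing one h = \int[mu]_(x in I) h x.
    move=> bh; rewrite (pairing_ae oneE)//.
    by apply: eq_Rintegral => x _; rewrite mul1r.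
  rewrite (pairing_ae vst mst bg) -pone; last exact: bounded_measurableM.
  have -> : pairing one (fun x => st x * g x) =
    \sum_(j < M.+1) c (ugrid M j) * pairing one (fun x => \1_(cell (ugrid M) j) x * g x).
    transitivity (pairing one (fun x => \sum_(j < M.+1)
        c (ugrid M j) * (\1_(cell (ugrid M) j) x * g x))).
      apply: pairing_eq => x _; rewrite /st mulr_suml.
      by apply: eq_bigr => j _; rewrite mulrA.
    rewrite pairing_sumr; last first.
      by move=> j; apply: bounded_measurableZ; exact: bounded_measurableM.
    by apply: eq_bigr => j _; rewrite pairingZr//; exact: bounded_measurableM.
  apply: (le_trans (ler_norm_sum _ _ _)); rewrite mulr_suml; apply: ler_sum => j _.
  rewrite normrM -mulrA ler_wpM2l// pone; last exact: bounded_measurableM.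
  apply: Rintegral_indic_itv => //.
  - by rewrite divr_ge0// ltW.
  - by rewrite ler_pdivrMr// mul1r ler_nat -ltnS.
  - by rewrite tS lerDl invr_ge0 ltW.
have uv : {ae mu, forall x, I x -> L1repr (u - v) x = L1repr u x - st x}.
  apply: lebesgue_aeS2 (L1reprB u v) vst => x E1 E2 Ix.
  by rewrite E1// E2.
have [mst _] := bst.
rewrite (L1norm_ae uv); last by apply: measurable_funB => //; exact: L1repr_measI.
have bc := test_fun_bounded_measurable (continuous_test_fun cc).
have iB g : bounded_measurable g ->
    mu.-integrable I (EFin \o (fun x => `|L1repr u x - g x|)%R).
  move=> bg; apply: integrable_norm.
  have := integrableB mI (L1repr_int u) (bounded_measurable_integrable bg).
  by apply: eq_integrable => // x _; rewrite /= EFinB.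
have icst (a : R) : mu.-integrable I (EFin \o (fun=> a)).
  by apply: bounded_measurable_integrable; exact: bounded_measurable_cst.
apply: (@le_trans _ _ (\int[mu]_(x in I) (`|L1repr u x - c x| + e / 2))).
  apply: le_Rintegral => //.
  - exact: iB.
  - by have := integrableD mI (iB _ bc) (icst (e / 2)); apply: eq_integrable.
  move=> x Ix; rewrite (_ : _ - _ = (L1repr u x - c x) + (c x - st x)); last by ring.
  by apply: (le_trans (ler_normD _ _)); rewrite lerD2l; exact: stE.
rewrite RintegralD//; last exact: iB.
rewrite Rintegral_cst//.
have -> : fine (mu I) = 1.
  by rewrite [X in fine X]lebesgue_unit_itv.
lra.
Qed.

End density.

(** * Uniform integrability of compact sets *)

Section uniform_integrability.
Context {R : realType}.
Notation mu := (@lebesgue_measure R).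
Notation I := (unit_itv R).
Notation L1 := (LspaceType1 (@leb01 R)).
Implicit Types (g h phi : R -> R) (x y : R) (u : L1).

Let mI : measurable (I : set (measurableTypeR R)) := unit_itvm.

Lemma L1dist_ge (c : R) u (F : set L1) : (forall v, F v -> c <= `|u - v|) ->
  (c%:E <= L1dist u F)%E.
Proof.
by move=> H; apply: le_ereal_inf_tmp => _ [v Fv <-]; rewrite lee_fin; exact: H.
Qed.

Lemma L1dist_le (c : R) u v (F : set L1) : F v -> `|u - v| <= c ->
  (L1dist u F <= c%:E)%E.
Proof.
move=> Fv uv; apply: (@le_trans _ _ `|u - v|%:E); last by rewrite lee_fin.
by apply: ereal_inf_lbound; exists v.
Qed.

Lemma open_cover_seq (E : seq R) (e : R) : 0 < e ->
  exists U : set R, [/\ open U, forall z, z \in E -> U z & (mu U <= e%:E)%E].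
Proof.
elim: E e => [|z E IH] e e0.
  exists set0; split=> //.
  by rewrite measure0 lee_fin ltW.
have [|U [oU UE mU]] := IH (e / 2); first by rewrite divr_gt0.
exists (ball z (e / 4) `|` U); split.
- by apply: openU => //; exact: ball_open.
- move=> w; rewrite inE => /predU1P[->|wE]; last by right; exact: UE.
  by left; apply: ballxx; rewrite divr_gt0.
apply: (le_trans (measureU2 _ _ _)).
- exact: measurable_ball.
- exact: open_measurable.
have -> : e%:E = ((e / 2)%:E + (e / 2)%:E)%E by rewrite -EFinD; congr EFin; field.
apply: leeD; last by [].
have e4 : 0 <= e / 4 by rewrite ltW// divr_gt0.
rewrite [X in (X <= _)%E](lebesgue_measure_ball _ e4).
by rewrite lee_fin -mulr_natr; lra.
Qed.

(** Near a given class, a bounded continuous approximation controls the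
    integrals over small sets; the bound is then uniform by compactness. *)
Lemma compact_uniformly_integrable (F : set L1) (e : R) : compact F -> 0 < e ->
  exists2 d : R, 0 < d & forall v (A : set R), F v -> measurable A ->
    (mu A <= d%:E)%E -> `|pairing v \1_A| <= e.
Proof.
move=> cF e0; have /compact_near_coveringP := cF.
move=> /(_ nat \oo (fun n v => forall A : set R, measurable A ->
    (mu A <= (n.+1%:R^-1)%:E)%E -> `|pairing v \1_A| <= e) _).
case.
  move=> v Fv; have e3 : 0 < e / 3 by rewrite divr_gt0.
  have [c cc vc] := L1_continuous_approx v e3.
  have [B cB] := continuous_bounded cc.
  have [N NB] : exists N : nat, (`|B| + 1) / (e / 3) <= N.+1%:R.
    by exists (Num.truncn ((`|B| + 1) / (e / 3))); rewrite ltW// truncnS_gt.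
  exists (ball v (e / 3), [set n | (N <= n)%N]) => /=.
    by split; [exact: nbhsx_ballx|exact: nbhs_infty_ge].
  move=> [w n] [/= vw Nn] A mA mAn.
  have bA := bounded_measurable_indic mA.
  have A1 x : I x -> `|\1_A x : R| <= 1.
    by move=> _; rewrite indicE; case: (_ \in _); rewrite ?normr1 ?normr0.
  have bc := test_fun_bounded_measurable (continuous_test_fun cc).
  have [cb cbE] := L1_of_bounded bc.
  have vcb : `|v - cb| <= e / 3.
    rewrite (@L1norm_ae _ _ (fun x => L1repr v x - c x))//.
      apply: lebesgue_aeS2 (L1reprB v cb) cbE => x E1 E2 Ix.
      by rewrite E1// E2.
    by apply: measurable_funB; [exact: L1repr_measI|have [] := bc].
  have wv : `|w - v| <= e / 3.
    by rewrite distrC; apply: ltW; exact: vw.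
  have h1 : `|pairing (w - v) \1_A| <= e / 3.
    by apply: le_trans wv; rewrite -[leRHS]mul1r; exact: le_pairing.
  have h2 : `|pairing (v - cb) \1_A| <= e / 3.
    by apply: le_trans vcb; rewrite -[leRHS]mul1r; exact: le_pairing.
  have h3 : `|pairing cb \1_A| <= e / 3.
    have [mc _] := bc.
    rewrite (pairing_ae cbE mc bA).
    apply: (le_trans (le_normr_Rintegral _ _)) => //.
      exact: (bounded_measurable_integrable (bounded_measurableM bc bA)).
    have muA : fine (mu (I `&` A)) <= n.+1%:R^-1.
      rewrite -lee_fin fineK; last first.
        rewrite ge0_fin_numE//; apply: (@le_lt_trans _ _ (mu A)).
          by apply: le_measure; rewrite ?inE//; exact: measurableI.
        by apply: (le_lt_trans mAn); rewrite ltry.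
      by apply: le_trans mAn; apply: le_measure; rewrite ?inE//; exact: measurableI.
    apply: (@le_trans _ _ (\int[mu]_(x in I) ((`|B| + 1) * \1_A x))).
      apply: le_Rintegral => //.
      - apply: integrable_norm.
        exact: (bounded_measurable_integrable (bounded_measurableM bc bA)).
      - exact: (bounded_measurable_integrable (bounded_measurableZ _ bA)).
      move=> x Ix; rewrite normrM indicE; case: (_ \in _); rewrite /= ?normr1 ?normr0 ?mulr0//.
      by rewrite !mulr1 (le_trans (cB x Ix))// (le_trans (ler_norm _))// lerDl.
    rewrite RintegralZl//; last exact: bounded_measurable_integrable.
    rewrite (_ : \int[mu]_(x in I) _ = fine (mu (I `&` A))); last first.
      by rewrite /Rintegral integral_indic// setIC.
    have B0 : 0 < `|B| + 1 by rewrite ltr_wpDl.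
    apply: (@le_trans _ _ ((`|B| + 1) * n.+1%:R^-1)); first by rewrite ler_pM2l.
    rewrite ler_pdivrMr ?ltr0n// mulrC -ler_pdivrMr//.
    by apply: (le_trans NB); rewrite ler_nat.
  rewrite (_ : w = (w - v) + (v - cb) + cb); last by rewrite addrA subrK subrK.
  rewrite (pairingDl _ _ bA) (pairingDl (w - v) _ bA); apply: (le_trans (ler_normD _ _)).
  have := ler_normD (pairing (w - v) \1_A) (pairing (v - cb) \1_A); lra.
move=> N _ /(_ N (leqnn N)) NP; exists (N.+1%:R^-1); first by rewrite invr_gt0 ltr0n.
by move=> v A Fv mA muA; exact: (NP v Fv A mA muA).
Qed.

End uniform_integrability.

(** * One-sided limits of derivatives on a branch *)

Section derivatives.
Context {R : realType}.
Notation I := (unit_itv R).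
Implicit Types (g G h : R -> R) (x y : R).

Lemma dnbhs_is_derive g x (d : R) :
  (g y - g x) / (y - x) @[y --> x^'] --> d -> is_derive x 1 g d.
Proof.
move=> gd.
have shift0 : (h + x) @[h --> (0 : R)^'] --> x^'.
  move=> A; rewrite /dnbhs /= => /nbhs_ballP[e /= e0 eA].
  apply/nbhs_ballP; exists e => //= h; rewrite /ball/= sub0r normrN => he h0.
  apply: eA; last by rewrite -subr_eq0 addrK.
  by rewrite /ball/= opprD addrCA subrr addr0 normrN.
have E : h^-1 *: ((g \o shift x) (h *: (1 : R)) - g x) @[h --> (0 : R)^'] --> d.
  have := cvg_comp _ _ shift0 gd; apply: cvg_trans; apply: near_eq_cvg.
  near=> h; rewrite /= addrK mulrC.
  by congr (_ * (g (_ + _) - _)); rewrite /GRing.scale/= mulr1.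
apply: DeriveDef; first by apply/cvg_ex; exists d.
by apply: cvg_lim => //; exact: Rhausdorff.
Unshelve. all: by end_near. Qed.

Lemma is_derive_dnbhs g x (d : R) : is_derive x 1 g d ->
  (g y - g x) / (y - x) @[y --> x^'] --> d.
Proof.
move=> [dg dgE].
have shift0 : (h - x) @[h --> x^'] --> (0 : R)^'.
  move=> A; rewrite /dnbhs /= => /nbhs_ballP[e /= e0 eA].
  apply/nbhs_ballP; exists e => //= h; rewrite /ball/= => he hx.
  apply: eA; last by rewrite subr_eq0.
  by rewrite /ball/= sub0r normrN distrC.
have E : h^-1 *: ((g \o shift x) (h *: (1 : R)) - g x) @[h --> (0 : R)^'] --> d.
  by rewrite -dgE; exact: dg.
have := cvg_comp _ _ shift0 E; apply: cvg_trans; apply: near_eq_cvg.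
near=> h; rewrite /= [RHS]mulrC.
by congr (_ * (g _ - _)); rewrite /GRing.scale/= mulr1 subrK.
Unshelve. all: by end_near. Qed.

Lemma dnbhs_filter_nbhs (F : set_system R) x : F `=>` x^' -> F `=>` nbhs x.
Proof.
by move=> Fx A xA; apply: Fx; rewrite /dnbhs /within /=; apply: filterS xA.
Qed.

(** A function is continuous at x along a filter along which its slopes
    converge.  Filters finer than punctured neighbourhoods cover the left, the
    right and the two-sided case at once. *)
Lemma cvg_of_slope (F : set_system R) g x (d : R) : ProperFilter F ->
  F `=>` x^' -> (g y - g x) / (y - x) @[y --> F] --> d -> g y @[y --> F] --> g x.
Proof.
move=> PF Fx gd.
have Fid : (y - x) @[y --> F] --> (0 : R).
  rewrite -(subrr x); apply: cvgB; last exact: cvg_cst.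
  exact: dnbhs_filter_nbhs.
have : (g y - g x) / (y - x) * (y - x) + g x @[y --> F] --> d * 0 + g x.
  by apply: cvgD; [exact: cvgM|exact: cvg_cst].
rewrite mulr0 add0r; apply: cvg_trans; apply: near_eq_cvg.
have Fn : \forall y \near F, y != x by apply: Fx; near=> z; near: z; exact: nbhs_dnbhs_neq.
near=> y; rewrite mulfVK ?subrK// subr_eq0.
by near: y.
Unshelve. all: by end_near. Qed.

Section branch.
Variables (J : set R) (g G g1 g2 : R -> R).
Hypothesis dG : deriv_on (closure J) G g1.
Hypothesis dg1 : deriv_on (closure J) g1 g2.
Hypothesis cg2 : {within closure J, continuous g2}.
Hypothesis gG : forall x, interior J x -> g x = G x.

Let nbhs_intJ y : interior J y -> \forall z \near y, interior J z.
Proof. by move=> Jy; exact: nbhs_interior. Qed.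

Let nbhs_clJ y : interior J y -> \forall z \near y, closure J z.
Proof.
move=> /nbhs_intJ; apply: filterS => z Jz.
exact: subset_closure (interior_subset Jz).
Qed.

Let deriv_on_int h h1 y : deriv_on (closure J) h h1 -> interior J y ->
  is_derive y 1 h (h1 y).
Proof.
move=> dh Jy; apply: dnbhs_is_derive.
have Ky : closure J y by exact: subset_closure (interior_subset Jy).
have := dh y Ky; apply: cvg_trans; apply: cvg_app.
move=> A KA; have yK : y^' (closure J).
  by rewrite /dnbhs /within /=; apply: filterS (nbhs_clJ Jy).
by apply: (@filterS2 _ y^' _ _ _ _ _ KA yK) => z /= + Kz; exact.
Qed.

Lemma branch_derive1 y : interior J y -> is_derive y 1 g (g1 y).
Proof.
move=> Jy; have := deriv_on_int dG Jy; apply: near_eq_is_derive.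
by move: (nbhs_intJ Jy); apply: filterS => z /gG.
Qed.

Lemma branch_derive1E y : interior J y -> derive1 g y = g1 y.
Proof. by move=> /branch_derive1 [_ <-]; rewrite derive1E. Qed.

Lemma branch_derive2 y : interior J y -> is_derive y 1 (derive1 g) (g2 y).
Proof.
move=> Jy; have := deriv_on_int dg1 Jy; apply: near_eq_is_derive.
by move: (nbhs_intJ Jy); apply: filterS => z /branch_derive1E.
Qed.

Lemma branch_derive2E y : interior J y -> derive1 (derive1 g) y = g2 y.
Proof. by move=> /branch_derive2 [_ <-]; rewrite derive1E. Qed.

Lemma branch_continuous2 y : interior J y ->
  {for y, continuous (derive1 (derive1 g))}.
Proof.
move=> Jy; rewrite /prop_for /continuous_at branch_derive2E//.
have Ky : closure J y := subset_closure (interior_subset Jy).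
have : g2 z @[z --> y] --> g2 y.
  have /subspace_continuousP/(_ y Ky) := cg2; apply: cvg_trans; apply: cvg_app.
  move=> A yA; have {}yA : \forall z \near y, closure J z -> A z by exact: yA.
  by apply: filterS2 yA (nbhs_clJ Jy) => z; exact.
apply: cvg_trans; apply: near_eq_cvg.
by apply: filterS (nbhs_intJ Jy) => z /branch_derive2E ->.
Qed.

Lemma within_filter_cvg (F : set_system R) x : ProperFilter F -> F `=>` x^' ->
  (\forall y \near F, interior J y) -> F `=>` within (closure J) x^'.
Proof.
move=> PF Fx FJ A; rewrite /within /= => /Fx; apply: filterS2 FJ => z Jz; apply.
exact: subset_closure (interior_subset Jz).
Qed.

Lemma filter_closure (F : set_system R) x : ProperFilter F -> F `=>` x^' ->
  (\forall y \near F, interior J y) -> closure J x.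
Proof.
move=> PF Fx FJ A xA.
have FA : F A by exact: (dnbhs_filter_nbhs Fx).
have [z [Jz Az]] := filter_ex (filterI FJ FA).
by exists z; split=> //; exact: interior_subset Jz.
Qed.

(** Slopes of G and g1 within the closure of J converge at x even when x is
    an end-point of J; hence g1 is continuous at x along F.  When g is derivable
    at x, it is continuous there, so g and G agree at x and their slopes have
    the same limit along F. *)
Lemma branch_limits (F : set_system R) x : ProperFilter F -> F `=>` x^' ->
  (\forall y \near F, interior J y) ->
  [/\ derive1 g y @[y --> F] --> g1 x,
      derive1 (derive1 g) y @[y --> F] --> g2 x &
      derivable g x 1 -> derive1 g x = g1 x].
Proof.
move=> PF Fx FJ; have Kx := filter_closure PF Fx FJ.
have FK := within_filter_cvg PF Fx FJ.
have FG : (G y - G x) / (y - x) @[y --> F] --> g1 x.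
  by apply: cvg_trans (dG Kx); exact: cvg_app.
split.
- have : g1 y @[y --> F] --> g1 x.
    apply: (@cvg_of_slope F g1 x (g2 x)) => //.
    by apply: cvg_trans (dg1 Kx); exact: cvg_app.
  apply: cvg_trans; apply: near_eq_cvg.
  by apply: filterS FJ => z /branch_derive1E ->.
- have : g2 y @[y --> F] --> g2 x.
    have /subspace_continuousP/(_ x Kx) := cg2; apply: cvg_trans; apply: cvg_app.
    move=> A; rewrite /within /= => xA; apply: FK; rewrite /within/= /dnbhs /within/=.
    have {}xA : \forall z \near x, closure J z -> A z by exact: xA.
    change (\forall z \near x, z != x -> closure J z -> A z).
    by apply: filterS xA => z + _; exact.
  apply: cvg_trans; apply: near_eq_cvg.
  by apply: filterS FJ => z /branch_derive2E ->.
- move=> dgx.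
  have gF : (g y - g x) / (y - x) @[y --> F] --> derive1 g x.
    have : is_derive x 1 g (derive1 g x) by apply: DeriveDef => //; rewrite derive1E.
    move/is_derive_dnbhs; apply: cvg_trans; exact: cvg_app.
  have gG_F : G y @[y --> F] --> g x.
    apply: cvg_trans (cvg_of_slope PF Fx gF); apply: near_eq_cvg.
    by apply: filterS FJ => z /gG ->.
  have gxE : g x = G x.
    exact: (cvg_unique (@Rhausdorff R) gG_F (cvg_of_slope PF Fx FG)).
  apply: (cvg_unique (@Rhausdorff R) _ FG).
  apply: cvg_trans gF; apply: near_eq_cvg.
  by apply: filterS FJ => z /gG ->; rewrite gxE.
Qed.

End branch.
End derivatives.

(** * Regularity of piecewise C2 maps off a finite set *)

Section piecewise.
Context {R : realType}.
Notation I := (unit_itv R).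
Implicit Types (g G h : R -> R) (x y : R).

(** The exceptional points are 0, 1 and the two ends of each piece: a point
    of a piece which is not one of its ends is interior to it, and an interval
    that contains no end lies in a single piece. *)
Lemma itv_partition_ends (n : nat) (J : 'I_n -> set R) :
  (forall j, is_interval (J j)) -> partition setT J I ->
  exists2 S : set R, finite_set S &
  [/\ S 0, S 1,
    (forall x, I x -> ~ S x -> exists j, interior (J j) x) &
    (forall a b : R, 0 <= a -> a < b -> b <= 1 -> (forall z : R, a < z < b -> ~ S z) ->
      exists j, forall z : R, a < z < b -> interior (J j) z)].
Proof.
move=> itvJ [covJ _ J0].
have JI j : J j `<=` I by rewrite -covJ; exact: bigcup_sup.
have lbJ j : has_lbound (J j).
  by exists 0 => y /JI; rewrite /= in_itv/= => /andP[].
have ubJ j : has_ubound (J j).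
  by exists 1 => y /JI; rewrite /= in_itv/= => /andP[].
have intJ j : interior (J j) = [set r | inf (J j) < r < sup (J j)].
  exact: interval_bounded_interior.
pose E := \bigcup_(j in [set: 'I_n]) [set inf (J j); sup (J j)].
have finE : finite_set E.
  by apply: bigcup_finite => // j _; exact: finite_set2.
have good x : I x -> ~ E x -> exists j, interior (J j) x.
  rewrite -covJ => -[j _ Jx] nEx; exists j; rewrite intJ /= !lt_neqAle.
  have -> : inf (J j) <= x by apply: ge_inf.
  have -> : x <= sup (J j) by apply: ub_le_sup.
  rewrite !andbT; apply/andP; split; apply/eqP => xE; apply: nEx; exists j => //.
    by left.
  by right.
exists (E `|` [set 0; 1]); first by rewrite finite_setU; split=> //; exact: finite_set2.
split; [by right; left|by right; right|by move=> x Ix nS; apply: good => // Ex; apply: nS; left|].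
move=> a b a0 ab b1 nS.
pose c := (a + b) / 2.
have cab : a < c < b by rewrite /c; apply/andP; lra.
have [||j] := good c.
- by rewrite /= in_itv/=; move: cab => /andP[? ?]; apply/andP; lra.
- by move=> Ec; apply: (nS c cab); left.
rewrite intJ /= => /andP[ic cs]; exists j => z /andP[az zb].
move: cab => /andP[ac cb].
have ia : inf (J j) <= a.
  rewrite leNgt; apply/negP => ai; apply: (nS (inf (J j))).
    by rewrite ai (lt_trans ic).
  by left; exists j => //; left.
have bs : b <= sup (J j).
  rewrite leNgt; apply/negP => sb; apply: (nS (sup (J j))).
    by rewrite sb (lt_trans ac).
  by left; exists j => //; right.
by rewrite intJ /= (le_lt_trans ia)// (lt_le_trans zb).
Qed.

Definition C2_at g x :=
  [/\ is_derive x 1 g (derive1 g x),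
      is_derive x 1 (derive1 g) (derive1 (derive1 g) x) &
      {for x, continuous (derive1 (derive1 g))}].

(** A one-sided neighbourhood of any point lies in a single piece, so
    one-sided limits of the first two derivatives exist everywhere, and agree
    with the derivative where there is one. *)
Lemma piecewise_C2_regularity g : piecewise_C2 g ->
  exists2 S : set R, finite_set S &
  [/\ (forall x, I x -> ~ S x -> 0 < x < 1 /\ C2_at g x) &
      (forall (F : set_system R) x, ProperFilter F -> F `=>` x^' ->
         (F = x^'+ /\ 0 <= x < 1) \/ (F = x^'- /\ 0 < x <= 1) ->
         exists c1 c2 : R, [/\ derive1 g y @[y --> F] --> c1,
           derive1 (derive1 g) y @[y --> F] --> c2 &
           derivable g x 1 -> derive1 g x = c1])].
Proof.
move=> [n [J [itvJ partJ C2J]]].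
have [S finS [S0 S1 good gap]] := itv_partition_ends itvJ partJ.
exists S => //; split.
  move=> x Ix nSx; have [j Jx] := good x Ix nSx.
  have [G [g1 [g2 [dG dg1 cg2]]] gG] := C2J j.
  have E1 := branch_derive1E dG gG; have E2 := branch_derive2E dG dg1 gG.
  have D1 := branch_derive1 dG gG; have D2 := branch_derive2 dG dg1 gG.
  split; last split.
  - move: Ix; rewrite /= in_itv/= !le_eqVlt => /andP[/predU1P[x0|->] /predU1P[x1|->]] //.
    + by exfalso; apply: nSx; rewrite -x0.
    + by exfalso; apply: nSx; rewrite -x0.
    + by exfalso; apply: nSx; rewrite x1.
  - by rewrite E1//; exact: D1.
  - by rewrite E2//; exact: D2.
  - exact: (branch_continuous2 dG dg1 cg2 gG).
move=> F x PF Fx side.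
have [a [b [a0 ab b1 nS Fab]]] : exists a b : R, [/\ 0 <= a, a < b, b <= 1,
    (forall z : R, a < z < b -> ~ S z) & \forall y \near F, a < y < b].
  have nS' : \forall z \near x, z != x -> ~ S z.
    have : closed (S `\ x) by apply: finite_closedR; exact: finite_setD.
    move=> /closed_openC oS.
    have : nbhs x (~` (S `\ x)).
      apply: open_nbhs_nbhs; split; first exact: oS.
      by move=> [_]; apply.
    by apply: filterS => z nSz zx Sz; apply: nSz; split=> //; exact/eqP.
  move: nS' => /nbhs_ballP[e /= e0 eS].
  case: side => [[-> /andP[x0 x1]]|[-> /andP[x0 x1]]].
    exists x, (Num.min 1 (x + e)); split=> //.
    - by rewrite lt_min x1 ltrDl.
    - by rewrite ge_min lexx.
    - move=> z; rewrite lt_min => /and3P[xz z1 zxe]; apply: eS; last by rewrite gt_eqF.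
      by rewrite /ball/= ltr_norml; apply/andP; lra.
    - near=> y; apply/andP; split; first by near: y; exact: nbhs_right_gt.
      by near: y; apply: nbhs_right_lt; rewrite lt_min x1 ltrDl.
  exists (Num.max 0 (x - e)), x; split=> //.
  - by rewrite le_max lexx.
  - by rewrite gt_max x0 ltrBlDr ltrDl.
  - move=> z; rewrite gt_max => /andP[/andP[z0 zxe] zx]; apply: eS; last by rewrite lt_eqF.
    by rewrite /ball/= ltr_norml; apply/andP; lra.
  - near=> y; apply/andP; split; last by near: y; exact: nbhs_left_lt.
    by near: y; apply: nbhs_left_gt; rewrite gt_max x0 ltrBlDr ltrDl.
have [j Jab] := gap a b a0 ab b1 nS.
have [G [g1 [g2 [dG dg1 cg2]]] gG] := C2J j.
have FJ : \forall y \near F, interior (J j) y by apply: filterS Fab => y; exact: Jab.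
have [L1 L2 L3] := branch_limits dG dg1 cg2 gG PF Fx FJ.
by exists (g1 x), (g2 x).
Unshelve. all: by end_near. Qed.

End piecewise.

(** * Uniform bounds from the mean expansion condition *)

Section bounds.
Context {R : realType}.
Notation I := (unit_itv R).
Implicit Types (g G h : R -> R) (x y : R).

Lemma right_dnbhs x : x^'+ `=>` x^'.
Proof.
move=> A; rewrite /at_right /dnbhs /within /=; apply: filterS => y yA xy.
by apply: yA; rewrite gt_eqF.
Qed.

Lemma left_dnbhs x : x^'- `=>` x^'.
Proof.
move=> A; rewrite /at_left /dnbhs /within /=; apply: filterS => y yA xy.
by apply: yA; rewrite lt_eqF.
Qed.

Context (k : nat) (p : 'I_k -> R) (f : 'I_k -> R -> R).

Definition invslope i x : R := (derive1 (f i) x)^-1.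
(** The derivative of the inverse slope 1 / f_i'. *)
Definition distortion i x : R :=
  - (derive1 (f i) x) ^- 2 * derive1 (derive1 (f i)) x.

(** A single index governs both the distance of the weighted sum to 1 and the
    size of the distortion.  The property is monotone in n, so that local
    bounds can be combined by compactness along n -> oo. *)
Definition slopes_le n x :=
  [/\ forall i, derive1 (f i) x != 0,
      \sum_(i < k) p i * `|invslope i x| <= 1 - n.+1%:R^-1 &
      forall i, `|distortion i x| <= n%:R].

Lemma slopes_le_mono n n' x : (n <= n')%N -> slopes_le n x -> slopes_le n' x.
Proof.
move=> nn' [s0 s1 s2]; split=> //.
- apply: (le_trans s1); rewrite lerD2l lerN2 lef_pV2 ?posrE ?ltr0n//.
  by rewrite ler_nat.
- by move=> i; apply: (le_trans (s2 i)); rewrite ler_nat.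
Qed.

(** All the quantities involved are continuous functions of the first two
    derivatives, as the limits of the first ones do not vanish. *)
Lemma slopes_le_near (F : set_system R) (c1 c2 : 'I_k -> R) : ProperFilter F ->
  (forall i, derive1 (f i) y @[y --> F] --> c1 i) ->
  (forall i, derive1 (derive1 (f i)) y @[y --> F] --> c2 i) ->
  slopes_subunit p c1 ->
  exists N, \forall y \near F, slopes_le N y.
Proof.
move=> PF F1 F2 [c10 sum1].
have Finv i : invslope i y @[y --> F] --> (c1 i)^-1 by apply: cvgV.
have Fdist i : distortion i y @[y --> F] --> - (c1 i) ^- 2 * c2 i.
  apply: cvgM => //; apply: cvgN; apply: cvgV; first by rewrite expf_neq0.
  by rewrite expr2; under eq_fun do rewrite expr2; apply: cvgM.
have Fsum : \sum_(i < k) p i * `|invslope i y| @[y --> F] -->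
    \sum_(i < k) p i / `|c1 i|.
  apply: cvg_sumR => i; apply: cvgM; first exact: cvg_cst.
  by rewrite -normfV; apply: cvg_norm.
have gap : 0 < 1 - \sum_(i < k) p i / `|c1 i| by rewrite subr_gt0.
have [N1 N1P] := invn_lt gap.
pose M := \sum_(i < k) (`|- (c1 i) ^- 2 * c2 i| + 1).
pose N := maxn N1 (Num.truncn M).+1.
exists N.
have near0 : \forall y \near F, forall i, derive1 (f i) y != 0.
  by apply: filter_forall => i; apply: cvgr_neq0 (F1 i) _.
have near1 : \forall y \near F, \sum_(i < k) p i * `|invslope i y| <= 1 - N1.+1%:R^-1.
  by apply: (cvgr_le _ Fsum); rewrite ltrBrDr addrC -ltrBrDr.
have near2 : \forall y \near F, forall i, `|distortion i y| <= `|- (c1 i) ^- 2 * c2 i| + 1.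
  apply: filter_forall => i; apply: cvgr_le (cvg_norm (Fdist i)) _ _.
  by rewrite ltrDl.
near=> y.
have y1 : \sum_(i < k) p i * `|invslope i y| <= 1 - N1.+1%:R^-1 by near: y.
have y2 : forall i, `|distortion i y| <= `|- (c1 i) ^- 2 * c2 i| + 1 by near: y.
split.
- by near: y.
- apply: (le_trans y1); rewrite lerD2l lerN2 lef_pV2 ?posrE ?ltr0n//.
  by rewrite ler_nat ltnS leq_maxl.
- move=> i; apply: (le_trans (y2 i)).
  apply: (@le_trans _ _ M).
    by rewrite /M (bigD1 i)//= lerDl sumr_ge0// => j _; rewrite addr_ge0.
  apply: (@le_trans _ _ (Num.truncn M).+1%:R); first by rewrite ltW// truncnS_gt.
  by rewrite ler_nat leq_maxr.
Unshelve. all: by end_near. Qed.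

Hypothesis f_C2 : forall i, piecewise_C2 (f i).
Hypothesis f_exp : mean_expanding p f.

(** Every point of [0,1] has a punctured neighbourhood where the bounds hold
    for large n: on each side the limits of the derivatives satisfy the
    expansion condition, either by hypothesis or because they are the
    derivatives.  Compactness of [0,1] then gives a common n. *)
Lemma mean_expanding_bounds : exists2 S : set R, finite_set S &
  [/\ forall x, I x -> ~ S x -> 0 < x < 1,
      forall x i, I x -> ~ S x -> C2_at (f i) x &
      exists N, forall x, I x -> ~ S x -> slopes_le N x].
Proof.
have /boolp.choice[S SP] : forall i, exists S : set R, finite_set S /\
  [/\ (forall x, I x -> ~ S x -> 0 < x < 1 /\ C2_at (f i) x) &
      (forall (F : set_system R) x, ProperFilter F -> F `=>` x^' ->
         (F = x^'+ /\ 0 <= x < 1) \/ (F = x^'- /\ 0 < x <= 1) ->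
         exists c1 c2 : R, [/\ derive1 (f i) y @[y --> F] --> c1,
           derive1 (derive1 (f i)) y @[y --> F] --> c2 &
           derivable (f i) x 1 -> derive1 (f i) x = c1])].
  by move=> i; have [S fS SP] := piecewise_C2_regularity (f_C2 i); exists S.
pose T := (\bigcup_(i in [set: 'I_k]) S i) `|` [set 0; 1].
have TS x i : ~ T x -> ~ S i x by move=> nT Sx; apply: nT; left; exists i.
have T01 x : I x -> ~ T x -> 0 < x < 1.
  rewrite /= in_itv/= !le_eqVlt => /andP[/predU1P[x0|->] /predU1P[x1|->]] // nT.
  - by exfalso; apply: nT; right; left; rewrite -x0.
  - by exfalso; apply: nT; right; left; rewrite -x0.
  - by exfalso; apply: nT; right; right; rewrite x1.
have reg x i : I x -> ~ T x -> C2_at (f i) x.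
  by move=> Ix nT; have [_ [/(_ x Ix (TS _ _ nT))[]]] := SP i.
exists T; first rewrite finite_setU; first split.
- by apply: bigcup_finite => // i _; have [] := SP i.
- exact: finite_set2.
split=> //.
have side (F : set_system R) x : ProperFilter F -> F `=>` x^' ->
   (F = x^'+ /\ 0 <= x < 1) \/ (F = x^'- /\ 0 < x <= 1) ->
   exists N, \forall y \near F, slopes_le N y.
  move=> PF Fx sideF.
  have Ix : I x.
    rewrite /= in_itv/=; case: sideF => -[_ /andP[a b]]; apply/andP; lra.
  have /boolp.choice[c1 c1P] : forall i, exists c1 : R, exists c2 : R,
      [/\ derive1 (f i) y @[y --> F] --> c1,
           derive1 (derive1 (f i)) y @[y --> F] --> c2 &
           derivable (f i) x 1 -> derive1 (f i) x = c1].
    by move=> i; have [_ [_ /(_ F x PF Fx sideF)]] := SP i.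
  have /boolp.choice[c2 cP] := c1P.
  apply: (slopes_le_near (c1 := c1) (c2 := c2)); try by move=> i; have [] := cP i.
  have [r1 r2] := f_exp Ix.
  have [regx|nregx] := pselect (0 < x < 1 /\ forall i, derivable (f i) x 1).
    have -> : c1 = (fun i => derive1 (f i) x).
      by apply/funext => i; have [_ _ ->] := cP i => //; exact: regx.2.
    exact: r1.
  have [rr rl] := r2 nregx.
  have c1E : c1 = fun i => lim (derive1 (f i) y @[y --> F]).
    apply/funext => i; apply/esym/cvg_lim; first exact: Rhausdorff.
    by have [] := cP i.
  by rewrite c1E; case: sideF => -[-> /andP[a b]]; [exact: rr|exact: rl].
have cI : compact I by exact: segment_compact.
have /compact_near_coveringP := cI.
move=> /(_ nat \oo (fun n y => I y -> ~ T y -> slopes_le n y) _).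
case.
  move=> x Ix.
  have right : exists N, \forall y \near x^'+, I y -> slopes_le N y.
    move: (Ix); rewrite /= in_itv/= => /andP[x0]; rewrite le_eqVlt => /predU1P[x1|x1].
      exists 0%N; near=> y; rewrite /= in_itv/= => /andP[_].
      by rewrite leNgt -[X in X < _]x1; have -> : x < y.
    have [|N NP] := side x^'+ x _ (right_dnbhs (x := x)).
      by left; rewrite x0 x1.
    by exists N; apply: filterS NP => y.
  have left : exists N, \forall y \near x^'-, I y -> slopes_le N y.
    move: (Ix); rewrite /= in_itv/= => /andP[+ x1]; rewrite le_eqVlt => /predU1P[x0|x0].
      exists 0%N; near=> y; rewrite /= in_itv/= => /andP[+ _].
      by rewrite leNgt [X in _ < X]x0; have -> : y < x.
    have [|N NP] := side x^'- x _ (left_dnbhs (x := x)).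
      by right; rewrite x0 x1.
    by exists N; apply: filterS NP => y.
  have [N1 N1P] := right; have [N2 N2P] := left.
  have [N3 N3P] : exists N, ~ T x -> slopes_le N x.
    have [Tx|nTx] := pselect (T x); first by exists 0%N.
    have [slopesx _] := f_exp Ix.
    have [|||N NP] := slopes_le_near (F := globally [set x])
        (c1 := fun i => derive1 (f i) x)
        (c2 := fun i => derive1 (derive1 (f i)) x) (globally_properfilter (erefl : [set x] x)).
    - by move=> i A /nbhs_singleton Ac y /= ->.
    - by move=> i A /nbhs_singleton Ac y /= ->.
    - apply: slopesx; split; first exact: T01.
      by move=> i; have [[]] := reg x i Ix nTx.
    by exists N => _; exact: NP.
  pose N := maxn N1 (maxn N2 N3).
  have N1N : (N1 <= N)%N by rewrite leq_maxl.
  have N2N : (N2 <= N)%N by rewrite /N maxnCA leq_maxl.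
  have N3N : (N3 <= N)%N by rewrite /N maxnA leq_maxr.
  have nearx : \forall y \near x, I y -> ~ T y -> slopes_le N y.
    have {}N1P : \forall y \near x, x < y -> I y -> slopes_le N1 y by exact: N1P.
    have {}N2P : \forall y \near x, y < x -> I y -> slopes_le N2 y by exact: N2P.
    apply: filterS2 N1P N2P => y h1 h2 Iy nTy.
    have [yx|xy|yx] := ltgtP y x.
    - exact: slopes_le_mono N2N (h2 yx Iy).
    - exact: slopes_le_mono N1N (h1 xy Iy).
    - by rewrite yx in nTy *; exact: slopes_le_mono N3N (N3P nTy).
  exists ([set y | I y -> ~ T y -> slopes_le N y], [set n | (N <= n)%N]) => /=.
    by split=> //; exact: nbhs_infty_ge.
  move=> [y n] [/= yP Nn] Iy nTy; exact: slopes_le_mono Nn (yP Iy nTy).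
move=> N _ /(_ N (leqnn N)) NP; exists N => x Ix nT; exact: (NP x).
Unshelve. all: end_near. Qed.

End bounds.

(** * The averaged operator *)

Section dynamics.
Context {R : realType}.
Notation mu := (@lebesgue_measure R).
Notation I := (unit_itv R).
Notation L1 := (LspaceType1 (@leb01 R)).
Implicit Types (g h phi : R -> R) (x y : R) (u : L1).

Lemma finite_subset1 (A : set R) : is_subset1 A -> finite_set A.
Proof.
move=> A1; have [[x Ax]|nA] := pselect (A !=set0).
  by apply: sub_finite_set (finite_set1 x) => y Ay; exact: A1.
suff -> : A = set0 by exact: finite_set0.
by apply/seteqP; split=> // y Ay; apply: nA; exists y.
Qed.

Context (k : nat) (p : 'I_k -> R) (f : 'I_k -> R -> R).
Hypothesis p_gt0 : forall i, 0 < p i.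
Hypothesis p_sum1 : \sum_(i < k) p i = 1.
Hypothesis f_X : forall i, set_fun I I (f i).
Hypothesis f_ns : forall i, nonsingular (f i).
Notation P := (mean_perron_frobenius p f).

Context (S : set R) (N : nat).
Hypothesis finS : finite_set S.
Hypothesis S01 : forall x, I x -> ~ S x -> 0 < x < 1.
Hypothesis regS : forall x i, I x -> ~ S x -> C2_at (f i) x.
Hypothesis slopesS : forall x, I x -> ~ S x -> slopes_le p f N x.

(** The adjoint of the averaged Perron-Frobenius operator. *)
Definition mean_koopman g x := \sum_(i < k) p i * g (f i x).

Lemma bounded_measurable_compf i g : bounded_measurable g ->
  bounded_measurable (fun x => g (f i x)).
Proof. by apply: bounded_measurable_comp => //; have [] := f_ns i. Qed.

Lemma bounded_measurable_koopman g : bounded_measurable g ->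
  bounded_measurable (mean_koopman g).
Proof.
move=> bg; apply: bounded_measurable_sum => i.
by apply: bounded_measurableZ; exact: bounded_measurable_compf.
Qed.

Lemma pairing_mean_perron_frobenius u g : bounded_measurable g ->
  pairing (P u) g = pairing u (mean_koopman g).
Proof.
move=> bg; rewrite pairing_suml// pairing_sumr; last first.
  by move=> i; apply: bounded_measurableZ; exact: bounded_measurable_compf.
apply: eq_bigr => i _; rewrite pairingZl// pairingZr; last first.
  exact: bounded_measurable_compf.
by rewrite pairing_perron_frobenius.
Qed.

Lemma mean_koopman_le g (B : R) : (forall x, I x -> `|g x| <= B) ->
  forall x, I x -> `|mean_koopman g x| <= B.
Proof.
move=> gB x Ix; apply: (le_trans (ler_norm_sum _ _ _)).
rewrite -[B]mul1r -p_sum1 mulr_suml; apply: ler_sum => i _.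
rewrite normrM gtr0_norm//; apply: ler_wpM2l; first exact: ltW.
by apply: gB; exact: f_X.
Qed.

(** Tested against its own sign, P u gives its norm, and averaging the
    sign along the maps keeps it bounded by 1. *)
Lemma mean_perron_frobenius_contraction u : `|P u| <= `|u|.
Proof.
rewrite -[leLHS]pairing_sg pairing_mean_perron_frobenius; last first.
  exact: bounded_measurable_sg.
apply: (le_trans (ler_norm _)); rewrite -[leRHS]mul1r.
apply: le_pairing; first exact/bounded_measurable_koopman/bounded_measurable_sg.
by apply: mean_koopman_le => x _; rewrite normr_sg; case: (_ != _).
Qed.

Lemma mean_perron_frobeniusB u v : P (u - v) = P u - P v.
Proof.
apply: pairing_inj => g bg; rewrite pairingBl// !pairing_mean_perron_frobenius//.
by rewrite pairingBl//; exact: bounded_measurable_koopman.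
Qed.

Lemma iter_mean_perron_frobeniusB n u v :
  iter n P (u - v) = iter n P u - iter n P v.
Proof. by elim: n => //= n ->; rewrite mean_perron_frobeniusB. Qed.

Lemma iter_mean_perron_frobenius_contraction n u : `|iter n P u| <= `|u|.
Proof.
elim: n => //= n; apply: le_trans; exact: mean_perron_frobenius_contraction.
Qed.

Lemma pairing_iter_mean_perron_frobenius n u g : bounded_measurable g ->
  pairing (iter n P u) g = pairing u (iter n mean_koopman g).
Proof.
elim: n g => //= n IH g bg.
rewrite pairing_mean_perron_frobenius// IH; last exact: bounded_measurable_koopman.
by rewrite -iterSr.
Qed.

Lemma S0 : S 0.
Proof.
apply: contrapT => nS; have := S01 _ nS; rewrite ltxx /= in_itv/= lexx ler01.
by move=> /(_ isT).
Qed.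

Lemma S1 : S 1.
Proof.
apply: contrapT => nS; have := S01 _ nS; rewrite ltxx andbF /= in_itv/= lexx ler01.
by move=> /(_ isT).
Qed.

(** Two preimages of c with no point of S between them would enclose a
    critical point, by the mean value theorem.  So a preimage is determined by
    the number of points of S below it. *)
Lemma finite_preimage1 i (c : R) : finite_set [set x | I x /\ ~ S x /\ f i x = c].
Proof.
have /finite_seqP[s sE] := finS.
set Z := [set x | _].
pose cnt t := count (fun z : R => z < t) s.
pose Zn n := Z `&` [set x | cnt x = n].
have ZZn : Z `<=` \bigcup_(n in `I_(size s).+1) Zn n.
  by move=> x Zx; exists (cnt x) => //=; rewrite ltnS count_size.
apply: sub_finite_set ZZn _; apply: bigcup_finite; first exact: finite_II.
move=> n _; apply: finite_subset1 => x y Zx Zy.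
wlog xy : x y Zx Zy / x < y.
  by move=> H; have [xy|xy|//] := ltgtP x y; [exact: H|apply/esym; exact: H].
exfalso; move: Zx Zy => [[Ix [nSx fx]] cx] [[Iy [nSy fy]] cy].
move: Ix Iy; rewrite /= !in_itv/= => /andP[x0 x1] /andP[y0 y1].
have noS z : x <= z <= y -> ~ S z.
  move=> /andP[]; rewrite le_eqVlt => /predU1P[<-//|xz].
  rewrite le_eqVlt => /predU1P[->//|zy] Sz.
  have zs : z \in s by rewrite sE in Sz.
  suff : (cnt x < cnt y)%N by rewrite cx cy ltnn.
  pose a := [pred t : R | t < x]; pose b := [pred t : R | x <= t < y].
  have -> : cnt y = count (predU a b) s.
    apply: eq_count => t /=; case: (ltP t x) => //= tx.
    by rewrite (lt_trans tx xy).
  have := count_predUI a b s.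
  have -> : count (predI a b) s = 0%N.
    apply/eqP; rewrite -leqn0 leqNgt -has_count; apply/hasPn => t _ /=.
    by case: (ltP t x).
  rewrite addn0 => ->; rewrite -[X in (X < _)%N]addn0 ltn_add2l -has_count.
  by apply/hasP; exists z => //=; rewrite (ltW xz).
have In z : x <= z <= y -> I z.
  by move=> /andP[xz zy]; rewrite /= in_itv/= (le_trans x0 xz) (le_trans zy).
have [z zxy|z zxy|] := @MVT R (f i) (derive1 (f i)) x y xy.
- have zxy' : x <= z <= y by move: zxy; rewrite in_itv/= => /andP[/ltW -> /ltW ->].
  by have [] := regS i (In z zxy') (noS z zxy').
- apply: continuous_in_subspaceT => w /set_mem; rewrite /= in_itv/= => wxy.
  have [[dw _] _ _] := regS i (In w wxy) (noS w wxy).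
  exact/differentiable_continuous/derivable1_diffP.
- move=> e; rewrite in_itv/= => /andP[/ltW xe /ltW ey].
  have exy : x <= e <= y by rewrite xe.
  have [/(_ i) ne _ _] := slopesS (In e exy) (noS e exy).
  rewrite fx fy subrr => /esym/eqP; rewrite mulf_eq0 (negbTE ne)/=.
  by rewrite subr_eq0 gt_eqF.
Qed.

Let D := I `\` S.

Lemma finite_preimage i (T : set R) : finite_set T ->
  finite_set [set x | D x /\ T (f i x)].
Proof.
move=> fT; apply: (@sub_finite_set _ _ (\bigcup_(c in T) [set x | I x /\ ~ S x /\ f i x = c])).
  by move=> x [[Ix nSx] Tx]; exists (f i x).
by apply: bigcup_finite => // c _; exact: finite_preimage1.
Qed.

(** The inverse slope and its derivative are set to 0 on the exceptional set, so
    that their bounds hold everywhere. *)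
Let W i : R -> R := invslope f i \_ D.
Let V i : R -> R := distortion f i \_ D.

Lemma nbhsD x : D x -> \forall y \near x, D y.
Proof.
move=> [Ix nSx]; have /andP[x0 x1] := S01 Ix nSx.
have : nbhs x (~` S).
  by apply: open_nbhs_nbhs; split => //; apply: closed_openC; exact: finite_closedR.
move=> nS; near=> y; split; last by near: y.
rewrite /= in_itv/=; apply/andP; split; near: y.
  exact: lt_le_nbhsr.
exact: lt_le_nbhsl.
Unshelve. all: by end_near. Qed.

Lemma branch_regularity x i : D x -> [/\ is_derive x 1 (f i) (derive1 (f i) x),
  derive1 (f i) x * W i x = 1, is_derive x 1 (W i) (V i x) & {for x, continuous (V i)}].
Proof.
move=> Dx; have [Ix nSx] := Dx; have [d1 d2 c2] := regS i Ix nSx.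
have [n0 _ _] := slopesS Ix nSx.
have nearw : \forall y \near x, invslope f i y = W i y.
  by apply: filterS (nbhsD Dx) => y Dy; rewrite /W patchE mem_set.
have nearv : \forall y \near x, distortion f i y = V i y.
  by apply: filterS (nbhsD Dx) => y Dy; rewrite /V patchE mem_set.
have wE : W i x = invslope f i x by rewrite /W patchE mem_set.
have vE : V i x = distortion f i x by rewrite /V patchE mem_set.
have c1 : {for x, continuous (derive1 (f i))}.
  by case: d2 => d2 _; exact/differentiable_continuous/derivable1_diffP.
split => //.
- by rewrite wE /invslope mulfV.
- rewrite vE; apply: near_eq_is_derive nearw _; exact: is_deriveV.
- rewrite /prop_for /continuous_at vE.
  have : distortion f i y @[y --> x] --> distortion f i x.
    apply: cvgM => //; apply: cvgN; apply: cvgV; first by rewrite expf_neq0.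
    by rewrite expr2; under eq_fun do rewrite expr2; apply: cvgM.
  by apply: cvg_trans; apply: near_eq_cvg; apply: filterS nearv.
Qed.

(** The primitive whose derivative is [koopman_deriv]. *)
Definition koopman_prim phi x := \sum_(i < k) p i * (phi (f i x) * W i x).
(** The averaged g o f_i, corrected by the distortion so as to be a
    derivative. *)
Definition koopman_deriv phi g x := \sum_(i < k) p i * (g (f i x) + phi (f i x) * V i x).
(** The points where [koopman_prim] may jump when phi jumps on T. *)
Definition koopman_sing (T : set R) :=
  S `|` \bigcup_(i in [set: 'I_k]) [set x | D x /\ T (f i x)].

Lemma finite_koopman_sing T : finite_set T -> finite_set (koopman_sing T).
Proof.
move=> fT; rewrite /koopman_sing finite_setU; split=> //.
by apply: bigcup_finite => // i _; exact: finite_preimage.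
Qed.

(** Chain and product rules: the factor W i cancels the derivative of f i.
    Outside the jumps, a kink of the new primitive is sent by some f i to a
    kink of phi. *)
Lemma prim_step (T : set R) phi g : T 0 -> T 1 -> prim T phi g ->
  prim (koopman_sing T) (koopman_prim phi) (koopman_deriv phi g).
Proof.
move=> T0 T1 [cphi [K fK dphi]].
have goodx x : 0 < x < 1 -> ~ koopman_sing T x ->
    D x /\ forall i, 0 < f i x < 1 /\ ~ T (f i x).
  move=> /andP[x0 x1] nQ.
  have Dx : D x.
    split; first by rewrite /= in_itv/= !ltW.
    by move=> Sx; apply: nQ; left.
  split=> // i; have nTf : ~ T (f i x) by move=> Tf; apply: nQ; right; exists i.
  split=> //; have := f_X i Dx.1; rewrite /= in_itv/= !le_eqVlt.
  by move=> /andP[/predU1P[E|->] /predU1P[E'|->]] //; exfalso; apply: nTf; rewrite -?E ?E'.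
have cf x i : D x -> {for x, continuous (f i)}.
  move=> Dx; have [[df _] _ _ _] := branch_regularity i Dx.
  exact/differentiable_continuous/derivable1_diffP.
have cw x i : D x -> {for x, continuous (W i)}.
  move=> Dx; have [_ _ [dw _] _] := branch_regularity i Dx.
  exact/differentiable_continuous/derivable1_diffP.
have cphif x i : D x -> 0 < f i x < 1 -> ~ T (f i x) -> {for x, continuous (phi \o f i)}.
  by move=> Dx f01 nT; apply: continuous_comp; [exact: cf|exact: cphi].
split.
  move=> x x01 /(goodx _ x01)[Dx fx].
  apply: cvg_sumR => i; have [f01 nT] := fx i.
  by apply: cvgM; [exact: cvg_cst|apply: cvgM; [exact: cphif|exact: cw]].
exists (\bigcup_(i in [set: 'I_k]) [set x | D x /\ K (f i x)]).
  by apply: bigcup_finite => // i _; exact: finite_preimage.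
move=> x x01 /(goodx _ x01)[Dx fx] nK.
have fK' i : ~ K (f i x) by move=> Kf; apply: nK; exists i.
have reg i : is_derive (f i x) 1 phi (g (f i x)) /\ {for f i x, continuous g}.
  by have [f01 nT] := fx i; apply: dphi.
split; last first.
  apply: cvg_sumR => i; have [f01 nT] := fx i; have [_ cg] := reg i.
  have [_ _ _ cv] := branch_regularity i Dx.
  apply: cvgM; first exact: cvg_cst.
  apply: cvgD; first by apply: (continuous_comp (f := f i)) => //; exact: cf.
  by apply: cvgM => //; exact: cphif.
have -> : koopman_prim phi = \sum_(i < k) (p i *: ((phi \o f i) * W i)).
  by apply/funext => y; rewrite fct_sumE.
apply: is_derive_sum => i; apply: is_deriveZ.
have [df fw dw _] := branch_regularity i Dx; have [dphii _] := reg i.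
have E := is_derive1_comp dphii df.
have := is_deriveM E dw; congr is_derive.
rewrite /GRing.scale/= addrC; congr (_ + _).
by rewrite mulrCA [W i x * _]mulrC fw mulr1.
Qed.

Let alpha : R := 1 - N.+1%:R^-1.

Lemma alpha_ge0 : 0 <= alpha.
Proof. by rewrite subr_ge0 invf_le1 ?ltr0n// ler1n. Qed.

Lemma alpha_lt1 : alpha < 1.
Proof. by rewrite ltrBlDr ltrDl invr_gt0 ltr0n. Qed.

Lemma weighted_slopes_le x : \sum_(i < k) p i * `|W i x| <= alpha.
Proof.
have [Dx|nDx] := pselect (D x).
  have [_ + _] := slopesS Dx.1 Dx.2; rewrite (eq_bigr (fun i => p i * `|W i x|))//.
  by move=> i _; rewrite /W patchE mem_set.
rewrite big1 ?alpha_ge0// => i _; rewrite /W patchE memNset//.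
by rewrite normr0 mulr0.
Qed.

Lemma distortion_le i x : `|V i x| <= N%:R.
Proof.
rewrite /V patchE; case: ifPn => [/set_mem Dx|_]; last by rewrite normr0.
by have [_ _ ->] := slopesS Dx.1 Dx.2.
Qed.

Lemma koopman_prim_le phi (A : R) : (forall x, I x -> `|phi x| <= A) ->
  forall x, I x -> `|koopman_prim phi x| <= alpha * A.
Proof.
move=> phiA x Ix; apply: (le_trans (ler_norm_sum _ _ _)).
have A0 : 0 <= A := le_trans (normr_ge0 _) (phiA x Ix).
apply: (@le_trans _ _ (\sum_(i < k) p i * `|W i x| * A)).
  apply: ler_sum => i _; rewrite !normrM gtr0_norm// -mulrA ler_wpM2l ?(ltW (p_gt0 i))//.
  rewrite mulrC; apply: ler_wpM2l => //.
  by apply: phiA; exact: f_X.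
by rewrite -mulr_suml ler_wpM2r// weighted_slopes_le.
Qed.

Lemma koopman_deriv_le phi g (A B : R) : (forall x, I x -> `|phi x| <= A) ->
  (forall x, I x -> `|g x| <= B) ->
  forall x, I x -> `|koopman_deriv phi g x| <= B + A * N%:R.
Proof.
move=> phiA gB x Ix; apply: (le_trans (ler_norm_sum _ _ _)).
rewrite -[leRHS]mul1r -[X in _ <= X * _]p_sum1 mulr_suml; apply: ler_sum => i _.
rewrite normrM gtr0_norm// ler_wpM2l ?(ltW (p_gt0 i))//.
rewrite (le_trans (ler_normD _ _))// lerD//; first by apply: gB; exact: f_X.
rewrite normrM; apply: ler_pM => //; last exact: distortion_le.
by apply: phiA; exact: f_X.
Qed.

Lemma prim_test_fun (T : set R) phi g (B : R) : finite_set T -> prim T phi g ->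
  (forall x, I x -> `|g x| <= B) -> test_fun g.
Proof.
move=> fT [_ [K fK dphi]] gB; split; last by exists B.
exists (T `|` K); first by rewrite finite_setU.
move=> x x01 nTK; apply: (dphi x x01 _ _).2 => H; apply: nTK; by [left|right].
Qed.

Lemma pairing_step (T : set R) phi g (A B : R) u : finite_set T -> T 0 -> T 1 ->
  prim T phi g -> (forall x, I x -> `|phi x| <= A) ->
  (forall x, I x -> `|g x| <= B) ->
  `|pairing (P u) g| <= `|pairing u (koopman_deriv phi g)| + N%:R * A * `|u|.
Proof.
move=> fT T0 T1 pg phiA gB.
have bg : bounded_measurable g.
  exact/test_fun_bounded_measurable/prim_test_fun/gB/pg.
have bQ : bounded_measurable (koopman_deriv phi g).
  apply/test_fun_bounded_measurable/(prim_test_fun (finite_koopman_sing fT) (prim_step T0 T1 pg)).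
  exact: (koopman_deriv_le phiA gB).
have bK := bounded_measurable_koopman bg.
have bE := bounded_measurableB bQ bK.
have Ebound x : I x -> `|koopman_deriv phi g x - mean_koopman g x| <= N%:R * A.
  move=> Ix; rewrite -sumrB.
  apply: (le_trans (ler_norm_sum _ _ _)).
  rewrite -[leRHS]mul1r -[X in _ <= X * _]p_sum1 mulr_suml; apply: ler_sum => i _.
  rewrite -mulrBr addrAC subrr add0r.
  rewrite normrM gtr0_norm// ler_wpM2l ?(ltW (p_gt0 i))//.
  rewrite normrM mulrC; apply: ler_pM => //; first exact: distortion_le.
  by apply: phiA; exact: f_X.
rewrite pairing_mean_perron_frobenius//.
have -> : pairing u (mean_koopman g) =
   pairing u (koopman_deriv phi g) - pairing u (fun x => koopman_deriv phi g x - mean_koopman g x).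
  by rewrite pairingBr//; ring.
apply: (le_trans (ler_normB _ _)); rewrite lerD2l.
exact: le_pairing.
Qed.

(** The set T and the constant C depend on n only, and not on the test
    function.  This is why jumps and kinks are distinguished: the kinks of the
    n-th primitive do depend on the test function. *)
Lemma pairing_iter n : exists (T : set R) (C : R),
  [/\ finite_set T, T 0, T 1, 0 <= C &
  forall phi g (A B : R), prim [set 0; 1] phi g -> (forall x, I x -> `|phi x| <= A) ->
    (forall x, I x -> `|g x| <= B) -> exists phi' g', [/\ prim T phi' g',
      (forall x, I x -> `|phi' x| <= alpha ^+ n * A),
      (exists B' : R, forall x, I x -> `|g' x| <= B') &
      forall u, `|pairing (iter n P u) g| <= `|pairing u g'| + C * A * `|u|]].
Proof.
elim: n => [|n [T [C [fT T0 T1 C0 IH]]]].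
  exists [set 0; 1], 0; split=> //; [by left|by right|].
  move=> phi g A B pg phiA gB; exists phi, g; split=> //.
  - by move=> x Ix; rewrite expr0 mul1r; exact: phiA.
  - by exists B.
  - by move=> u; rewrite !mul0r addr0.
exists (koopman_sing T), (C + N%:R * alpha ^+ n); split.
- exact: finite_koopman_sing.
- by left; exact: S0.
- by left; exact: S1.
- by rewrite addr_ge0// mulr_ge0// exprn_ge0// alpha_ge0.
move=> phi g A B pg phiA gB.
have [phi' [g' [pg' phi'A [B' g'B'] IHu]]] := IH phi g A B pg phiA gB.
exists (koopman_prim phi'), (koopman_deriv phi' g'); split.
- exact: prim_step.
- by move=> x Ix; rewrite exprS -mulrA; apply: koopman_prim_le.
- by exists (B' + alpha ^+ n * A * N%:R); exact: koopman_deriv_le.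
move=> u; rewrite iterSr; apply: (le_trans (IHu (P u))).
have := pairing_step u fT T0 T1 pg' phi'A g'B'.
have A0 : 0 <= A by apply: le_trans (phiA 0 _) => //; rewrite /= in_itv/= lexx ler01.
have := mean_perron_frobenius_contraction u.
move=> /(ler_wpM2l (mulr_ge0 C0 A0)) h1 h2.
apply: (le_trans (lerD h2 h1)).
rewrite -addrA lerD2l [leRHS](_ : _ = N%:R * (alpha ^+ n * A) * `|u| + C * A * `|u|)//.
by ring.
Qed.

Lemma prim_prim0_self g : test_fun g -> prim [set 0; 1] (prim0 g) g.
Proof.
move=> tg; have bg := test_fun_bounded_measurable tg; have [[T fT cT] _] := tg.
split; first by move=> x x01 _; exact: prim0_continuous.
exists T => // x x01 _ nT; split; last exact: cT.
by apply: prim0_derive => //; exact: cT.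
Qed.

(** Centering the n-th test function on the gaps between its jumps turns its
    primitive, of sup norm alpha ^ n A with jumps, into a continuous one of sup
    norm at most 2 alpha ^ n A; the averages removed are at most 2 alpha ^ n A
    divided by the lengths of the gaps. *)
Lemma lasota_yorke n : exists2 C : R, 0 <= C &
  forall u (K : R), var_le u K -> var_le (iter n P u) (2 * alpha ^+ n * K + C * `|u|).
Proof.
have [T [C0 [fT T0 T1 C00 HT]]] :=
  pairing_iter n.
have [m [t [t0 tm t_lt tT]]] := finite_grid fT T0 T1.
pose Ct := \sum_(j < m) (t j.+1 - t j)^-1.
have al0 : 0 <= alpha ^+ n by rewrite exprn_ge0// alpha_ge0.
have d0 j : (j < m)%N -> 0 < t j.+1 - t j by move=> jm; rewrite subr_gt0 t_lt.
have Ct0 : 0 <= Ct by apply: sumr_ge0 => j _; rewrite invr_ge0 ltW// d0.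
exists (2 * alpha ^+ n * Ct + C0); first by rewrite addr_ge0// !mulr_ge0.
move=> u K uK g A tg gA.
have [_ [B gB]] := tg.
have [phi' [g' [pg' phi'A [B' g'B'] Hu]]] := HT _ _ _ _ (prim_prim0_self tg) gA gB.
have tg' : test_fun g' := prim_test_fun fT pg' g'B'.
have bg' := test_fun_bounded_measurable tg'.
have A0 : 0 <= A.
  by apply: (le_trans (normr_ge0 _) (gA 0 _)); rewrite /= in_itv/= lexx ler01.
pose A' := 2 * (alpha ^+ n * A).
have A'0 : 0 <= A' by rewrite !mulr_ge0.
have cells j x : (j < m)%N -> t j <= x <= t j.+1 ->
     `|prim0 g' x - prim0 g' (t j)| <= A' /\ `|prim0 g' (t j.+1) - prim0 g' x| <= A'.
  move=> jm /andP[jx xj].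
  have tj0 := grid_ge0 t0 t_lt (ltnW jm).
  have tj1 := grid_le1 tm t_lt jm.
  split; apply: (prim_prim0_le bg' pg' phi'A) => //.
  - exact: le_trans tj1.
  - by move=> z /andP[jz zx]; apply: (tT j) => //; rewrite jz (lt_le_trans zx).
  - exact: le_trans jx.
  - by move=> z /andP[jz zx]; apply: (tT j) => //; rewrite zx (le_lt_trans jx).
apply: (le_trans (Hu u)).
have H1 := pairing_cellavg_le t m u bg'.
have H2 := uK _ A' (test_fun_sub_cellavg t m tg') (prim0_sub_cellavg t0 tm t_lt bg' cells A'0).
have H3 : \sum_(j < m) `|avg t g' j| * `|pairing u \1_(cell t j)| <= A' * Ct * `|u|.
  rewrite /Ct mulr_sumr mulr_suml; apply: ler_sum => j _.
  apply: ler_pM => //.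
    rewrite /avg normrM normfV (gtr0_norm (d0 j _))// ler_wpM2r//.
      by rewrite invr_ge0 ltW// d0.
    by have [] := cells j (t j.+1) (ltn_ord j) ltac:(by rewrite lexx ltW// t_lt).
  rewrite -[leRHS]mul1r; apply: le_pairing; first exact: bounded_measurable_cell.
  by move=> x _; rewrite indicE; case: (_ \in _); rewrite ?normr1 ?normr0.
apply: (@le_trans _ _ (K * A' + A' * Ct * `|u| + C0 * A * `|u|)).
  by rewrite lerD2r (le_trans H1)// lerD.
by rewrite /A' le_eqVlt; apply/orP; left; apply/eqP; ring.
Qed.

(** With M such that 2 alpha ^ M <= 1/2, the variation at the times q M
    satisfies V_(q+1) <= V_q / 2 + 2 C_M, hence is eventually at most
    1 + 4 C_M; the at most M - 1 remaining steps at most double it and add a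
    constant. *)
Lemma var_le_attractor : exists K0 : R, forall u (K : R), `|u| <= 2 -> var_le u K ->
  \forall n \near \oo, var_le (iter n P u) K0.
Proof.
have [M [M0 aM]] : exists M, (0 < M)%N /\ 2 * alpha ^+ M <= 2^-1.
  have al : `|alpha| < 1 by rewrite ger0_norm ?alpha_ge0// alpha_lt1.
  have := cvg_expr al; move/cvgrPdist_le => /(_ 4^-1 ltac:(by rewrite invr_gt0)) [M _ HM].
  exists M.+1; split => //; have := HM M.+1 (leqnSn M).
  rewrite sub0r normrN /= => /(le_trans (ler_norm _)); lra.
have /boolp.choice[C CP] : forall n, exists C : R, 0 <= C /\
  forall u (K : R), var_le u K -> var_le (iter n P u) (2 * alpha ^+ n * K + C * `|u|).
  by move=> n; have [C C0 HC] := lasota_yorke n; exists C.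
pose K1 : R := 1 + 4 * C M.
pose K0 : R := 2 * K1 + 2 * \sum_(r < M) C r.
exists K0 => u K u2 uK.
have nu n : `|iter n P u| <= 2.
  exact: le_trans (iter_mean_perron_frobenius_contraction n u) u2.
have step v (L : R) n : `|v| <= 2 -> var_le v L ->
    var_le (iter n P v) (2 * alpha ^+ n * L + C n * 2).
  move=> v2 vL; have [C0 HC] := CP n; apply: var_le_mono (HC _ _ vL).
  by rewrite lerD2l; apply: ler_wpM2l.
have CM0 : 0 <= C M by have [] := CP M.
have big q : var_le (iter (q * M) P u) (2^-1 ^+ q * `|K| + 4 * C M).
  elim: q => [|q IH].
    rewrite mul0n expr0 mul1r; apply: var_le_mono uK.
    by rewrite (le_trans (ler_norm _))// lerDl mulr_ge0.
  rewrite mulSn iterD; apply: var_le_mono (step _ _ M (nu _) IH).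
  have L0 : 0 <= 2^-1 ^+ q * `|K| + 4 * C M.
    by rewrite addr_ge0 ?mulr_ge0// exprn_ge0// invr_ge0.
  have := ler_wpM2r L0 aM; rewrite exprS; set X := 2^-1 ^+ q; nra.
have half : `|2^-1 : R| < 1 by rewrite ger0_norm ?invr_ge0// invf_lt1 ?ltr1n.
have := cvg_expr half; move/cvgrPdist_le.
have e0 : 0 < (`|K| + 1)^-1 by rewrite invr_gt0 ltr_wpDl.
move=> /(_ _ e0)[Q _ HQ].
exists (Q * M)%N => // n /= Qn.
have Qq : (Q <= n %/ M)%N by rewrite leq_divRL.
rewrite (divn_eq n M) addnC iterD.
have q1 : 2^-1 ^+ (n %/ M) * `|K| <= 1.
  have := HQ (n %/ M)%N Qq; rewrite sub0r normrN ger0_norm; last first.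
    by rewrite exprn_ge0// invr_ge0.
  move=> /(ler_wpM2r (normr_ge0 K)) /le_trans; apply.
  by rewrite mulrC ler_pdivrMr ?ltr_wpDl// mul1r lerDl.
have vK1 : var_le (iter (n %/ M * M) P u) K1.
  by apply: var_le_mono (big _); rewrite lerD2r.
have rM : (n %% M < M)%N by rewrite ltn_mod.
apply: var_le_mono (step _ _ (n %% M)%N (nu _) vK1).
have K10 : 0 <= K1 by rewrite addr_ge0// mulr_ge0.
rewrite /K0; apply: lerD.
  rewrite -mulrA ler_pM2l// ler_piMl//.
  by rewrite exprn_ile1 ?alpha_ge0// ltW// alpha_lt1.
rewrite mulrC ler_pM2l// (bigD1 (Ordinal rM))//= lerDl.
by apply: sumr_ge0 => j _; have [] := CP j.
Qed.

Lemma constrictive_mean : constrictive P.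
Proof.
have [K0 attr] := var_le_attractor.
exists (var_ball 2 K0); first exact: compact_var_ball.
move=> h [_ h1].
have dist_ge0 n : (0 <= L1dist (iter n P h) (var_ball 2 K0))%E.
  by apply: L1dist_ge => v _.
have dist_le (e : R) : 0 < e ->
    \forall n \near \oo, (L1dist (iter n P h) (var_ball 2 K0) <= e%:E)%E.
  move=> e0.
  have [|v [K vK hv]] := var_le_dense h (e := Num.min e 1).
    by rewrite lt_min e0 ltr01.
  have v2 : `|v| <= 2.
    rewrite (_ : v = h - (h - v)); last by rewrite subKr.
    apply: (le_trans (ler_normB _ _)); rewrite h1 (_ : 2 = 1 + 1)// lerD2l.
    by apply: (le_trans hv); rewrite ge_min lexx orbT.
  apply: filterS (attr v K v2 vK) => n vn.
  apply: (L1dist_le (v := iter n P v)).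
    split=> //; apply: le_trans v2.
    exact: (iter_mean_perron_frobenius_contraction).
  rewrite -iter_mean_perron_frobeniusB//.
  apply: (le_trans (iter_mean_perron_frobenius_contraction _ _)).
  by apply: (le_trans hv); rewrite ge_min lexx.
apply/fine_cvgP; split.
  apply: filterS (dist_le 1 ltr01) => n le1.
  by rewrite ge0_fin_numE//; apply: (le_lt_trans le1); rewrite ltry.
apply/cvgrPdist_le => e e0; apply: filterS (dist_le e e0) => n le_e.
rewrite /= sub0r normrN ger0_norm ?fine_ge0// -lee_fin fineK//.
by rewrite ge0_fin_numE//; apply: (le_lt_trans le_e); rewrite ltry.
Qed.

Notation koop := mean_koopman.

(** E lists the end-points of the orbits of length n of x, along all choices of
    maps.  These orbits avoid the break points, so each n-fold composition is
    continuous at x and sends a neighbourhood of x into U. *)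
Lemma koopman_indic_near n : exists2 T : set R, finite_set T &
  forall x, 0 < x < 1 -> ~ T x -> exists E : seq R, forall U : set R, open U ->
    (forall z, z \in E -> U z) -> \forall y \near x, iter n koop \1_U y = 1.
Proof.
elim: n => [|n [T fT HT]].
  exists set0 => // x _ _; exists [:: x] => U oU UE.
  have Ux : U x by apply: UE; rewrite inE.
  have : nbhs x U by exact: open_nbhs_nbhs.
  by apply: filterS => y Uy; rewrite /= indicE mem_set.
exists (koopman_sing (T `|` [set 0; 1])).
  apply: (finite_koopman_sing); rewrite finite_setU; split=> //.
move=> x x01 nQ.
have Ix : I x by move: x01 => /andP[? ?]; rewrite /= in_itv/= !ltW.
have nSx : ~ S x by move=> Sx; apply: nQ; left.
have nT i : ~ (T `|` [set 0; 1]) (f i x).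
  by move=> Tf; apply: nQ; right; exists i.
have f01 i : 0 < f i x < 1.
  have := f_X i Ix; rewrite /= in_itv/= !le_eqVlt.
  move=> /andP[/predU1P[E|->] /predU1P[E'|->]] //; exfalso; apply: (nT i); right;
  by [left|right|left; rewrite E].
have /boolp.choice[E EP] : forall i, exists E : seq R, forall U : set R, open U ->
    (forall z, z \in E -> U z) -> \forall y \near f i x, iter n koop \1_U y = 1.
  by move=> i; apply: HT => // Tf; apply: (nT i); left.
exists (flatten [seq E i | i <- enum 'I_k]) => U oU UE.
have near_i : \forall y \near x, forall i : 'I_k, iter n koop \1_U (f i y) = 1.
  apply: (@filter_forall _ _ (fun i y => iter n koop \1_U (f i y) = 1) (nbhs x)) => i.
  have cf : {for x, continuous (f i)}.
    have [[df _] _ _] := regS i Ix nSx.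
    exact/differentiable_continuous/derivable1_diffP.
  have near_fi : \forall z \near f i x, iter n koop \1_U z = 1.
    apply: EP => // z zE; apply: UE.
    by apply/flattenP; exists (E i) => //; apply: map_f; rewrite mem_enum.
  exact: (cf _ near_fi).
apply: filterS near_i => y yi.
by rewrite iterS /mean_koopman -p_sum1; apply: eq_bigr => i _; rewrite yi mulr1.
Qed.

(** The normalised indicator of a small ball around a point as in the previous
    lemma has its n-th image carried by U, whose measure is so small that the
    elements of F have integral at most 1/2 on it. *)
Lemma iter_density_far n (F : set L1) : compact F ->
  exists2 h : L1, densities h & (2^-1%:E <= L1dist (iter n P h) F)%E.
Proof.
move=> cF; have h0 : 0 < 2^-1 :> R by rewrite invr_gt0.
have [d d0 Fd] := compact_uniformly_integrable cF h0.
have [T fT HT] := koopman_indic_near n.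
have [x x01 nTx] : exists2 x : R, 0 < x < 1 & ~ T x.
  apply: contrapT => nx.
  have sub : `]0, 1[%classic `<=` T.
    move=> x /=; rewrite in_itv/= => x01; apply: contrapT => nT; apply: nx; by exists x.
  have : mu `]0%R, 1%R[%classic = 0%E.
    apply: countable_lebesgue_measure0; apply: finite_set_countable.
    exact: sub_finite_set sub fT.
  rewrite [X in X = _]lebesgue_measure_itv/= lte_fin ltr01 sube0 => /eqP.
  by rewrite eqe oner_eq0.
have [E EP] := HT x x01 nTx.
have [U [oU UE mU]] := open_cover_seq E d0.
have near1 := EP U oU UE.
have mUm : measurable U := open_measurable oU.
have near01 : \forall y \near x, 0 < y < 1.
  move: x01 => /andP[x0 x1]; near=> y; apply/andP; split; near: y.
    exact: lt_nbhsr.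
  exact: lt_nbhsl.
have /nbhs_ballP[r /= r0 rP] : \forall y \near x, iter n koop \1_U y = 1 /\ 0 < y < 1.
  by apply: filterS2 near1 near01.
have rI : ball x r `<=` I.
  by move=> y /rP[_ /andP[? ?]]; rewrite /= in_itv/= !ltW.
have mB : measurable (ball x r : set R) by exact: measurable_ball.
have bB := bounded_measurable_indic mB.
pose h y : R := (2 * r)^-1 * \1_(ball x r) y.
have r2 : 0 < (2 * r)^-1 by rewrite invr_gt0 mulr_gt0.
have bh : bounded_measurable h by exact: bounded_measurableZ.
have [mh _] := bh.
have inth : \int[mu]_(y in I) h y = 1.
  rewrite RintegralZl//; last exact: bounded_measurable_integrable.
  rewrite /Rintegral integral_indic//= setIidl//.
  rewrite [X in fine X]lebesgue_measure_ball/= ?ltW//.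
  have -> : r *+ 2 = 2 * r by rewrite mulr_natl.
  by rewrite mulVf// gt_eqF// mulr_gt0.
have [H HE] := L1_of_bounded bh.
have h_ge0 y : 0 <= h y.
  by rewrite /h mulr_ge0 ?(ltW r2)// indicE; case: (_ \in _).
have densH : densities H.
  split.
    by apply/leb01_I_ae; apply: lebesgue_aeS HE => y Hy Iy; rewrite Hy.
  rewrite (L1norm_ae HE)// -[RHS]inth; apply: eq_Rintegral => y _.
  by rewrite ger0_norm.
exists H => //; apply: L1dist_ge => v Fv.
have bU := bounded_measurable_indic mUm.
have U1 y : I y -> `|\1_U y : R| <= 1.
  by move=> _; rewrite indicE; case: (_ \in _); rewrite ?normr1 ?normr0.
have pH : pairing (iter n P H) \1_U = 1.
  rewrite pairing_iter_mean_perron_frobenius//.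
  rewrite (pairing_ae HE)//; last first.
    by elim: (n) => //= m IH; apply: bounded_measurable_koopman.
  rewrite -[RHS]inth; apply: eq_Rintegral => y _.
  rewrite /h indicE; have [/set_mem By|] := boolP (y \in _); last by rewrite mulr0 mul0r.
  by rewrite (rP y By).1 mulr1.
have pv := Fd v U Fv mUm mU.
have : `|pairing (iter n P H - v) \1_U| <= `|iter n P H - v|.
  by rewrite -[leRHS]mul1r; exact: le_pairing.
apply: le_trans; rewrite pairingBl// pH; apply: le_trans (ler_norm _).
have := le_trans (ler_norm _) pv; lra.
Unshelve. all: by end_near. Qed.

Lemma not_uniformly_constrictive_mean : ~ uniformly_constrictive P.
Proof.
move=> [F cF /fine_cvgP[finF]].
have e0 : 0 < 4^-1 :> R by rewrite invr_gt0.
move=> /cvgrPdist_le /(_ _ e0) small.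
have [n [fn]] := filter_ex (filterI finF small).
rewrite /= sub0r normrN => sn.
have [h dh far] := iter_density_far n cF.
have : (2^-1%:E <= (4^-1)%:E :> \bar R)%E.
  apply: (le_trans far); apply: (@le_trans _ _
     (ereal_sup [set L1dist (iter n P h) F | h in densities])).
    by apply: ereal_sup_ubound; exists h.
  rewrite -(fineK fn) lee_fin; apply: le_trans sn; exact: ler_norm.
by rewrite lee_fin; lra.
Qed.

End dynamics.

Theorem proposition1p17 (R : realType) (k : nat) (p : 'I_k -> R)
    (f : 'I_k -> R -> R)
    (k_ge1 : (1 <= k)%N)
    (p_gt0 : forall i, 0 < p i)
    (p_sum1 : \sum_(i < k) p i = 1)
    (f_X : forall i, set_fun (unit_itv R) (unit_itv R) (f i))
    (f_C2 : forall i, piecewise_C2 (f i))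
    (f_ns : forall i, nonsingular (f i))
    (f_exp : mean_expanding p f) :
  constrictive (mean_perron_frobenius p f) /\
  ~ uniformly_constrictive (mean_perron_frobenius p f).

Proof.
have [S finS [S01 regS [N slopesS]]] := mean_expanding_bounds f_C2 f_exp.
split.
  exact: (constrictive_mean p_gt0 p_sum1 f_X f_ns finS S01 regS slopesS).
exact: (not_uniformly_constrictive_mean p_sum1 f_X f_ns finS regS slopesS).
Qed.
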